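(* Let $(E,\mathcal{E})$ be a measurable space and let $(\eta_l)_{l\ge 0}$, $(G_l)_{l\ge 0}$, $(M_l)_{l\ge 1}$, $Z_l$ and the particle system be as described in the context. Assume (A1) and (A2). Then there exist constants $C<+\infty$ and $\kappa\in(0,1)$, not depending on $L$ or on the particle numbers, such that for every $L\ge 1$, every choice of integers $N_0\ge N_1\ge\cdots\ge N_{L-1}\ge 1$ and every $g\in\mathcal{B}_b(E)$ with $\|g\|_\infty=1$, the estimator $$\widehat{Y}=\eta_0^{N_0}(g)+\sum_{l=1}^{L}\Big\{\frac{\eta_{l-1}^{N_{l-1}}(gG_{l-1})}{\eta_{l-1}^{N_{l-1}}(G_{l-1})}-\eta_{l-1}^{N_{l-1}}(g)\Big\}$$ satisfies \begin{align*} \mathbb{E}\big[\{\widehat{Y}-\eta_L(g)\}^2\big] \le C\bigg(&\frac{1}{N_0}+\sum_{l=1}^{L}\frac{\|\tfrac{Z_{l-1}}{Z_l}G_{l-1}-1\|_\infty^2}{N_{l-1}}\\ &+\sum_{1\le l<q\le L}\|\tfrac{Z_{l-1}}{Z_l}G_{l-1}-1\|_\infty\,\|\tfrac{Z_{q-1}}{Z_q}G_{q-1}-1\|_\infty\Big\{\frac{\kappa^{q-l}}{N_{l-1}}+\frac{1}{N_{l-1}^{1/2}N_{q-1}}\Big\}\bigg). \end{align*}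
   Context: $(E,\mathcal{E})$ is a measurable space with a finite dominating measure $du$. For $l\ge0$, $\gamma_l:E\to(0,\infty)$ is measurable with $Z_l=\int_E\gamma_l(u)\,du\in(0,\infty)$, and $\eta_l(du)=\gamma_l(u)du/Z_l$ is a probability measure. Set $G_l=\gamma_{l+1}/\gamma_l$ for $l\ge0$. For $l\ge1$, $M_l$ is a Markov kernel on $E$ with $\eta_lM_l=\eta_l$. Notation: $\mathcal{B}_b(E)$ is the set of bounded measurable real functions, $\|f\|_\infty=\sup_u|f(u)|$, $\mu(f)=\int f\,d\mu$, $M_lf(u)=\int f(v)M_l(u,dv)$. Particle system: given integers $N_0\ge N_1\ge\cdots$, the particles $U_0^1,\dots,U_0^{N_0}$ are i.i.d. with law $\eta_0$; for $l\ge1$, conditionally on all particles at levels $0,\dots,l-1$, the particles $U_l^1,\dots,U_l^{N_l}$ are i.i.d. with law $\sum_{i=1}^{N_{l-1}}G_{l-1}(U_{l-1}^i)M_l(U_{l-1}^i,\cdot)\big/\sum_{i=1}^{N_{l-1}}G_{l-1}(U_{l-1}^i)$ (resampling by weights $G_{l-1}$ followed by an $M_l$ move). $\eta_l^{N_l}=\frac1{N_l}\sum_{i=1}^{N_l}\delta_{U_l^i}$ is the empirical measure, so $\eta_l^{N_l}(\varphi)=\frac1{N_l}\sum_i\varphi(U_l^i)$. Expectations are with respect to the law of this particle system. (A1): there exist $0<\underline{C}<\overline{C}<\infty$ with $\underline C\le G_l(u)\le\overline C$ for all $l\ge1$, $u\in E$. (A2): there exists $\rho\in(0,1)$ with $M_l(u,A)\ge\rho\,M_l(v,A)$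 for all $l\ge1$, $u,v\in E$, $A\in\mathcal{E}$. *)

(* Defs.v *)
From HB Require Import structures.
From mathcomp Require Import all_boot all_order all_algebra.
From mathcomp Require Import all_classical all_reals all_analysis.
Set Implicit Arguments. Unset Strict Implicit. Unset Printing Implicit Defensive.
Import Order.TTheory GRing.Theory Num.Theory.
Import numFieldNormedType.Exports.
Local Open Scope classical_set_scope.
Local Open Scope ring_scope.

Section Defs.
Context {R : realType} {d : measure_display} {E : measurableType d}.

Definition supnorm (f : E -> R) : \bar R :=
  ereal_sup [set (`|f u|)%:E | u in [set: E]].

Definition bmeas (f : E -> R) : Prop :=
  measurable_fun [set: E] f /\ exists c : R, forall u, `|f u| <= c.

Definition Zc (mu : {measure set E -> \bar R}) (gam : nat -> E -> R) (l : nat) : R :=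
  fine (\int[mu]_u (gam l u)%:E).

Definition eta_ (mu : {measure set E -> \bar R}) (gam : nat -> E -> R) (l : nat)
  (f : E -> R) : R :=
  fine (\int[mu]_u (f u * gam l u)%:E) / Zc mu gam l.

Definition Gp (gam : nat -> E -> R) (l : nat) (u : E) : R := gam l.+1 u / gam l u.

Definition kapply (M : nat -> R.-pker E ~> E) (l : nat) (f : E -> R) (u : E) : R :=
  fine (\int[M l u]_v (f v)%:E).

Definition Phi (gam : nat -> E -> R) (M : nat -> R.-pker E ~> E) (l n : nat)
  (x : nat -> E) (f : E -> R) : R :=
  (\sum_(j < n) Gp gam l.-1 (x j) * kapply M l f (x j)) /
  (\sum_(j < n) Gp gam l.-1 (x j)).

(* Law of the particle system (levels 0 .. L-1) on a probability space:
   U l i is the i-th particle (i < N l) at level l.  The law is specified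
   through product test functions of bounded measurable functions, which
   characterises: level 0 i.i.d. eta_0, and level l i.i.d. with law
   Phi(U_{l-1}) conditionally on all particles of levels 0..l-1. *)
Definition particle_system {d' : measure_display} {Om : measurableType d'}
  (P : probability Om R) (mu : {measure set E -> \bar R}) (gam : nat -> E -> R)
  (M : nat -> R.-pker E ~> E) (N : nat -> nat) (L : nat)
  (U : nat -> nat -> Om -> E) : Prop :=
  (forall l i, measurable_fun [set: Om] (U l i)) /\
  (forall f : nat -> E -> R, (forall i, bmeas (f i)) ->
     (\int[P]_w (\prod_(i < N 0%N) f i (U 0%N i w))%:E =
      (\prod_(i < N 0%N) eta_ mu gam 0 (f i))%:E)%E) /\
  (forall l, (1 <= l < L)%N ->
   forall (h : nat -> nat -> E -> R) (f : nat -> E -> R),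
     (forall k j, bmeas (h k j)) -> (forall i, bmeas (f i)) ->
     (\int[P]_w ((\prod_(k < l) \prod_(j < N k) h k j (U k j w)) *
                 \prod_(i < N l) f i (U l i w))%:E =
      \int[P]_w ((\prod_(k < l) \prod_(j < N k) h k j (U k j w)) *
                 \prod_(i < N l) Phi gam M l (N l.-1) (fun j => U l.-1 j w) (f i))%:E)%E).

Definition emp {d' : measure_display} {Om : measurableType d'}
  (N : nat -> nat) (U : nat -> nat -> Om -> E) (l : nat) (f : E -> R) (w : Om) : R :=
  (N l)%:R^-1 * \sum_(i < N l) f (U l i w).

Definition Yhat {d' : measure_display} {Om : measurableType d'}
  (gam : nat -> E -> R) (N : nat -> nat) (U : nat -> nat -> Om -> E) (L : nat)
  (g : E -> R) (w : Om) : R :=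
  emp N U 0 g w +
  \sum_(1 <= l < L.+1)
     (emp N U l.-1 (fun u => g u * Gp gam l.-1 u) w / emp N U l.-1 (Gp gam l.-1) w
      - emp N U l.-1 g w).

Definition dnorm (mu : {measure set E -> \bar R}) (gam : nat -> E -> R) (l : nat) : \bar R :=
  supnorm (fun u => Zc mu gam l.-1 / Zc mu gam l * Gp gam l.-1 u - 1).

Definition rhs_bound (mu : {measure set E -> \bar R}) (gam : nat -> E -> R)
  (N : nat -> nat) (L : nat) (kappa : R) : \bar R :=
  ((N 0%N)%:R^-1)%:E +
  (\sum_(1 <= l < L.+1) dnorm mu gam l * dnorm mu gam l * ((N l.-1)%:R^-1)%:E)%E +
  (\sum_(1 <= l < L.+1) \sum_(l.+1 <= q < L.+1)
     dnorm mu gam l * dnorm mu gam q *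
     (kappa ^+ (q - l) / (N l.-1)%:R +
      (Num.sqrt ((N l.-1)%:R) * (N q.-1)%:R)^-1)%:E)%E.

End Defs.

(* Main.v *)
(** Write e_p = eta_p^N - eta_p and D_p = (Z_p / Z_(p+1)) G_p - 1.  Since eta_p(D_p) = 0, the
    p-th centred increment X_p of the estimator is e_p(g D_p) - A_p e_p(D_p), where A_p is the
    updated empirical mean of g and |A_p| <= 1; equivalently X_p = e_p(h_p) - (A_p - a_p) e_p(D_p)
    with a_p = eta_(p+1)(g) and h_p = (g - a_p) D_p, a linear term plus a product of two errors.
    No lower bound on G_0 is needed, and if G_0 is unbounded the right-hand side is infinite.

    Pushing the empirical measures through the Feynman-Kac flow telescopes e_r(h) into one
    sampling error per level s <= r, contracted by kappa^(r-s) (Doeblin) and of L^4 size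
    N_s^(-1/2) (fourth moment of a martingale).  For p < r the terms with s <= p of
    E[X_p e_r(h_r)] are bounded by Cauchy-Schwarz, giving kappa^(r-p) / N_p; in the terms with
    s > p the first-order part of the sampling error is orthogonal to X_p, and the quadratic
    remainder gives N_p^(-1/2) / N_r because N is nonincreasing. *)

Require Import Defs.
From HB Require Import structures.
From mathcomp Require Import all_boot all_order all_algebra.
From mathcomp Require Import all_classical all_reals all_analysis.
From mathcomp Require Import measurable_realfun ring lra.
Import Order.TTheory GRing.Theory Num.Theory.
Import numFieldNormedType.Exports.
Local Open Scope classical_set_scope.
Local Open Scope ring_scope.

(** * Bounded measurable functions *)

(** [particle_system] describes the law only by integrals of products of one-particle functions, so
    no conditional expectation is ever formed. Dependence on the past is expressed by the [bclosure]
    of such products, and orthogonality passes from products to the closure by linearity and bounded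
    convergence. The ratios that occur (updated means, conditional laws) stay in the closure thanks
    to a geometric series. Fourth moments are needed because the covariance of two increments
    contains X_p times a product of two errors: Cauchy-Schwarz asks for the L^2 size of that
    product, hence for the L^4 size of each factor. The rate 1 - rho^2 and the oscillation constant
    Cu / (Cl rho) do not depend on the number of steps. (A1) says nothing about G_0, so the bound K
    on all normalised weights is built from the norm of D_0 and from Cu / Cl, and the contraction
    starts at level 1, which costs a factor 1 / kappa in [C1]. *)

Section BoundedMeasurable.
Context {R : realType} {d : measure_display} {T : measurableType d}.
Implicit Types f g : T -> R.

Lemma bmeas_cst (c : R) : bmeas (fun _ : T => c).
Proof. by split; [exact: measurable_cst | exists `|c|]. Qed.

Lemma bmeas_lin a {f g} : bmeas f -> bmeas g -> bmeas (fun x => a * f x + g x).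
Proof.
move=> [mf [b fb]] [mg [c gc]]; split.
  by apply: measurable_funD => //; apply: measurable_funM => //; exact: measurable_cst.
exists (`|a| * b + c) => x.
by rewrite (le_trans (ler_normD _ _))// lerD// normrM ler_wpM2l.
Qed.

Lemma bmeasM {f g} : bmeas f -> bmeas g -> bmeas (fun x => f x * g x).
Proof.
move=> [mf [b fb]] [mg [c gc]]; split; first exact: measurable_funM.
by exists (b * c) => x; rewrite normrM ler_pM.
Qed.

Lemma bmeasD {f g} : bmeas f -> bmeas g -> bmeas (fun x => f x + g x).
Proof. by move=> bf bg; have := bmeas_lin 1 bf bg; under eq_fun do rewrite mul1r. Qed.

Lemma bmeasZ a {f} : bmeas f -> bmeas (fun x => a * f x).
Proof. by move=> bf; have := bmeas_lin a bf (bmeas_cst 0); under eq_fun do rewrite addr0. Qed.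

Lemma bmeasN {f} : bmeas f -> bmeas (fun x => - f x).
Proof. by move=> bf; have := bmeasZ (-1) bf; under eq_fun do rewrite mulN1r. Qed.

Lemma bmeasB {f g} : bmeas f -> bmeas g -> bmeas (fun x => f x - g x).
Proof. by move=> bf bg; apply: (bmeasD bf (bmeasN bg)). Qed.

Lemma bmeas_norm {f} : bmeas f -> bmeas (fun x => `|f x|).
Proof.
move=> [mf [b fb]]; split; first exact: measurableT_comp.
by exists b => x; rewrite normr_id.
Qed.

Lemma bmeasX n {f} : bmeas f -> bmeas (fun x => f x ^+ n).
Proof.
move=> bf; elim: n => [|n IH]; first by under eq_fun do rewrite expr0; exact: bmeas_cst.
by under eq_fun do rewrite exprS; exact: bmeasM.
Qed.

Lemma bmeas_sum I (s : seq I) (F : I -> T -> R) :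
  (forall i, bmeas (F i)) -> bmeas (fun x => \sum_(i <- s) F i x).
Proof.
move=> bF; elim: s => [|i s IH]; first by under eq_fun do rewrite big_nil; exact: bmeas_cst.
by under eq_fun do rewrite big_cons; exact: bmeasD.
Qed.

Lemma bmeas_prod I (s : seq I) (F : I -> T -> R) :
  (forall i, bmeas (F i)) -> bmeas (fun x => \prod_(i <- s) F i x).
Proof.
move=> bF; elim: s => [|i s IH]; first by under eq_fun do rewrite big_nil; exact: bmeas_cst.
by under eq_fun do rewrite big_cons; exact: bmeasM.
Qed.

Lemma bmeas_lim (F : nat -> T -> R) f (c : R) : (forall n, bmeas (F n)) ->
  (forall n x, `|F n x| <= c) -> (forall x, F ^~ x @ \oo --> f x) -> bmeas f.
Proof.
move=> bF Fc Ff; split.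
  by apply: (@measurable_fun_cvg _ _ _ setT F) => [m|x _]; [case: (bF m) | exact: Ff].
exists c => x.
have Fx : (fun n => `|F n x|) @ \oo --> `|f x| by apply: cvg_norm; exact: Ff.
rewrite -(cvg_lim _ Fx)//; apply: limr_le; first by apply/cvg_ex; exists `|f x|.
by apply: nearW => n /=; exact: Fc.
Qed.

(* Closure under linear combinations and bounded pointwise limits; it plays the
   role of "measurable with respect to a sub-sigma-algebra". *)
Inductive bclosure (P : (T -> R) -> Prop) : (T -> R) -> Prop :=
| bclosure_base f : P f -> bclosure P f
| bclosure_lin a f g : bclosure P f -> bclosure P g ->
    bclosure P (fun x => a * f x + g x)
| bclosure_lim (F : nat -> T -> R) f (c : R) : (forall n, bclosure P (F n)) ->
    (forall n x, `|F n x| <= c) -> (forall x, F ^~ x @ \oo --> f x) -> bclosure P f.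

Arguments bclosure_base {P f}.
Arguments bclosure_lin {P} a {f g}.
Arguments bclosure_lim {P}.

Lemma bclosure_bmeas {P : (T -> R) -> Prop} {f} :
  (forall f, P f -> bmeas f) -> bclosure P f -> bmeas f.
Proof.
move=> bP; elim=> [{}f /bP //|a {}f g _ bf _ bg|F {}f c _ bF Fc Ff].
- exact: bmeas_lin.
- exact: bmeas_lim Ff.
Qed.

(** * Products and quotients in the bounded closure *)

Section BoundedClosure.
Context {P : (T -> R) -> Prop} (P1 : P (fun=> 1)) (bP : forall f, P f -> bmeas f).

Lemma bclosureD {f g} : bclosure P f -> bclosure P g -> bclosure P (fun x => f x + g x).
Proof.
move=> cf cg; have := bclosure_lin 1 cf cg.
by under eq_fun do rewrite mul1r.
Qed.

Lemma bclosure0 : bclosure P (fun _ => 0).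
Proof.
have c1 := bclosure_base P1; have := bclosure_lin (-1) c1 c1.
by under eq_fun do rewrite mulr1 addNr.
Qed.

Lemma bclosureZ a {f} : bclosure P f -> bclosure P (fun x => a * f x).
Proof.
move=> cf; have := bclosure_lin a cf bclosure0.
by under eq_fun do rewrite addr0.
Qed.

Lemma bclosure_cst c : bclosure P (fun=> c).
Proof. by have := bclosureZ c (bclosure_base P1); under eq_fun do rewrite mulr1. Qed.

Lemma bclosureB {f g} : bclosure P f -> bclosure P g -> bclosure P (fun x => f x - g x).
Proof.
move=> cf cg; have := bclosureD cf (bclosureZ (-1) cg).
by under eq_fun do rewrite mulN1r.
Qed.

Lemma bclosure_sum I (s : seq I) (F : I -> T -> R) :
  (forall i, bclosure P (F i)) -> bclosure P (fun x => \sum_(i <- s) F i x).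
Proof.
move=> cF; elim: s => [|i s IH]; first by under eq_fun do rewrite big_nil; exact: bclosure0.
by under eq_fun do rewrite big_cons; exact: bclosureD.
Qed.

Context (PM : forall f g, P f -> P g -> P (fun x => f x * g x)).

(** Two inductions: on the right factor with a generator on the left, then on the left factor. The
    factor held fixed is bounded, so the products in the limit case keep a uniform bound. *)
Lemma bclosureM {f g} : bclosure P f -> bclosure P g -> bclosure P (fun x => f x * g x).
Proof.
have MP h k : P h -> bclosure P k -> bclosure P (fun x => h x * k x).
  move=> Ph; elim=> [{}k Pk|a {}k l _ ck _ cl|F {}k c _ cF Fc Fk].
  - by apply: bclosure_base; exact: PM.
  - have := bclosure_lin a ck cl; congr bclosure; apply/funext => x; ring.
  - have [_ [b hb]] := bP _ Ph.
    apply: (@bclosure_lim _ (fun n x => h x * F n x) _ (b * c)) => //.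
      by move=> n x; rewrite normrM; apply: ler_pM.
    by move=> x; apply: cvgM; [exact: cvg_cst | exact: Fk].
move=> cf cg; elim: cf => [h Ph|a h k ch IHh ck IHk|F h c cF IH Fc Fh].
- exact: MP.
- have := bclosure_lin a IHh IHk; congr bclosure; apply/funext => x; ring.
- have [_ [b gb]] := bclosure_bmeas bP cg.
  apply: (@bclosure_lim _ (fun n x => F n x * g x) _ (c * b)) => //.
    by move=> n x; rewrite normrM; apply: ler_pM.
  by move=> x; apply: cvgM; [exact: Fh | exact: cvg_cst].
Qed.

Lemma bclosureX n {f} : bclosure P f -> bclosure P (fun x => f x ^+ n).
Proof.
move=> cf; elim: n => [|n IH]; first by under eq_fun do rewrite expr0; exact: bclosure_cst.
by under eq_fun do rewrite exprS; exact: bclosureM.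
Qed.

(* f / g = sum over k of (f / B) (1 - g / B)^k when 0 < g <= B. *)
Lemma bclosure_div {f g} {c : R} : bclosure P f -> bclosure P g ->
  (forall x, 0 < g x) -> (forall x, `|f x| <= c * g x) ->
  bclosure P (fun x => f x / g x).
Proof.
move=> cf cg g0 fg; have [_ [b gb]] := bclosure_bmeas bP cg.
pose B := `|b| + 1.
have B0 : 0 < B by rewrite ltr_pwDr.
have gB x : g x <= B.
  by rewrite (le_trans (ler_norm _))// (le_trans (gb x))// ler_wpDr// ler_norm.
have q0 x : 0 <= 1 - g x / B by rewrite subr_ge0 ler_pdivrMr// mul1r.
have q1 x : 1 - g x / B < 1 by rewrite ltrBlDr ltrDl divr_gt0.
pose F n x := \sum_(0 <= k < n) (B^-1 * f x) * (1 - B^-1 * g x) ^+ k.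
have FE n x : F n x = (f x / g x) * (1 - (1 - g x / B) ^+ n).
  rewrite /F -mulr_sumr [B^-1 * g x]mulrC; set z := 1 - g x / B.
  have -> : \sum_(0 <= k < n) z ^+ k = (1 - z ^+ n) / (1 - z).
    have nz : 1 - z != 0 by rewrite subr_eq0 eq_sym lt_eqF// /z q1.
    apply/eqP; rewrite eq_sym (can2_eq (divfK nz) (mulfK nz)); apply/eqP.
    elim: n => [|n IH]; first by rewrite big_nil expr0 subrr mul0r.
    by rewrite big_nat_recr//= mulrDl -IH exprSr; ring.
  have -> : 1 - z = g x / B by rewrite /z opprB addrC subrK.
  have := g0 x => g0x; field; rewrite !gt_eqF//.
(* The domination of |f| by c g bounds every partial sum by c, although 1 / g itself may be
   unbounded. *)
apply: (@bclosure_lim _ F _ c).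
- move=> n; apply: bclosure_sum => k.
  apply: bclosureM; first exact: bclosureZ.
  by apply: bclosureX; apply: bclosureB; [exact: bclosure_cst | exact: bclosureZ].
- move=> n x; rewrite FE normrM normf_div.
  have -> : c = c * 1 by rewrite mulr1.
  apply: ler_pM => //.
    by rewrite ler_pdivrMr ?normr_gt0 ?gt_eqF// (gtr0_norm (g0 x)).
  have zn1 : (1 - g x / B) ^+ n <= 1 by rewrite exprn_ile1// ltW.
  by rewrite ger0_norm ?subr_ge0// lerBlDr lerDl exprn_ge0.
- move=> x; rewrite (_ : F^~ x = fun n => (f x / g x) * (1 - (1 - g x / B) ^+ n)); last first.
    by apply/funext => n; rewrite FE.
  suff : (fun n => (f x / g x) * (1 - (1 - g x / B) ^+ n)) @ \oo --> (f x / g x) * (1 - 0).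
    by rewrite subr0 mulr1.
  apply: cvgM; first exact: cvg_cst.
  apply: cvgB; first exact: cvg_cst.
  by apply: cvg_expr; rewrite ger0_norm.
Qed.

End BoundedClosure.

(** The closure generated by all bounded measurable functions is that class itself, so
    [bclosure_div] applies with [bmeas] as the generators. *)
Lemma bmeas_div {f g} {c : R} : bmeas f -> bmeas g ->
  (forall x, 0 < g x) -> (forall x, `|f x| <= c * g x) -> bmeas (fun x => f x / g x).
Proof.
move=> bf bg g0 fg; apply: (@bclosure_bmeas bmeas) => //.
by apply: (bclosure_div _ _ _ _ _ g0 fg) => //; [exact: bmeas_cst | move=> *; exact: bmeasM
  | exact: bclosure_base | exact: bclosure_base].
Qed.

Import HBNNSimple.

Definition indicator f := exists2 A, measurable A & f = \1_A.

Lemma indicator_bmeas f : indicator f -> bmeas f.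
Proof.
move=> [A mA ->]; split; first exact: measurable_indic.
by exists 1 => x; rewrite indicE; case: (_ \in _); rewrite ?normr1 ?normr0.
Qed.

(** Serves as an induction principle: a property stable under linear combinations and bounded limits
    need only be checked on indicators. *)
Lemma bmeas_bclosure_indic f : bmeas f -> bclosure indicator f.
Proof.
set P := indicator.
have P1 : P (fun=> 1) by exists setT => //; apply/funext => x; rewrite indicT.
move=> [mf [b fb]].
(* The increasing approximation by simple functions concerns nonnegative functions; the shift by b
   is undone at the end. *)
pose h x := f x + b.
have h0 x : 0 <= h x by rewrite /h -lerBlDr sub0r; have := fb x; rewrite ler_norml => /andP[].
have mh : measurable_fun setT (EFin \o h).
  by apply/measurable_EFinP; apply: measurable_funD => //; exact: measurable_cst.
pose F := nnsfun_approx measurableT mh.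
have cF n : bclosure P (F n).
  rewrite (_ : (F n : T -> R) = fun x => \sum_(y \in range (F n)) (y * \1_(F n @^-1` [set y]) x)); last first.
    by apply/funext => x; rewrite {1}fimfunE.
  under eq_fun do rewrite fsbig_finite//=.
  apply: bclosure_sum => // y; apply: bclosureZ => //; apply: bclosure_base.
  by exists (F n @^-1` [set y]).
have Fh x : (F^~ x) n @[n --> \oo] --> h x.
  have := @cvg_nnsfun_approx _ _ _ _ measurableT (EFin \o h) mh (fun x _ => h0 x) x I.
  by move/fine_cvgP => [_].
have Fle n x : F n x <= h x.
  by have := @le_approx _ _ _ setT (EFin \o h) n x (fun x _ => h0 x) I;
     rewrite -(nnsfun_approxE measurableT mh) lee_fin.
have ch : bclosure P h.
  apply: (@bclosure_lim _ F _ (b + b)) => // n x.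
  rewrite ger0_norm//; apply: le_trans (Fle n x) _.
  by rewrite lerD2r (le_trans (ler_norm _)).
have := bclosureB P1 ch (bclosure_cst P1 b).
by under eq_fun do rewrite addrK.
Qed.

End BoundedMeasurable.

(** * Means and their L2 and L4 bounds *)

Section Means.
Context {R : realType} {d : measure_display} {T : measurableType d}.
Implicit Types (f g : T -> R) (I : (T -> R) -> R).

(** Common interface for the expectation, the measures eta_l, the kernels, the empirical measures
    and the conditional laws, so that inequalities are proved once for all of them. *)
Definition mean I := [/\ I (fun=> 1) = 1,
  (forall a f g, bmeas f -> bmeas g -> I (fun x => a * f x + g x) = a * I f + I g) &
  (forall f, bmeas f -> (forall x, 0 <= f x) -> 0 <= I f)].

Definition bcontinuous I := forall (F : nat -> T -> R) f (c : R),
  (forall n, bmeas (F n)) -> (forall n x, `|F n x| <= c) ->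
  (forall x, F ^~ x @ \oo --> f x) -> (fun n => I (F n)) @ \oo --> I f.

Context {I : (T -> R) -> R} (mI : mean I).

Lemma meanD {f g} : bmeas f -> bmeas g -> I (fun x => f x + g x) = I f + I g.
Proof.
move=> bf bg; have [_ L _] := mI; rewrite -[I f]mul1r -L//.
by under [in RHS]eq_fun do rewrite mul1r.
Qed.

Lemma mean0 : I (fun _ => 0) = 0.
Proof.
have [_ L _] := mI; have := L (-1) _ _ (bmeas_cst 0) (bmeas_cst 0).
by under eq_fun do rewrite mulr0 addr0; rewrite mulN1r addNr.
Qed.

Lemma meanZ a {f} : bmeas f -> I (fun x => a * f x) = a * I f.
Proof.
move=> bf; have [_ L _] := mI; rewrite -[RHS]addr0 -mean0 -L//; last exact: bmeas_cst.
by under [in RHS]eq_fun do rewrite addr0.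
Qed.

Lemma meanB {f g} : bmeas f -> bmeas g -> I (fun x => f x - g x) = I f - I g.
Proof.
move=> bf bg; rewrite meanD//; last exact: bmeasN.
congr (_ + _); rewrite -mulN1r -meanZ//.
by under [in RHS]eq_fun do rewrite mulN1r.
Qed.

Lemma mean_cst c : I (fun=> c) = c.
Proof.
have [I1 _ _] := mI; rewrite -[RHS]mulr1 -I1 -meanZ; last exact: bmeas_cst.
by under [in RHS]eq_fun do rewrite mulr1.
Qed.

Lemma mean_ge0 {f} : bmeas f -> (forall x, 0 <= f x) -> 0 <= I f.
Proof. by have [_ _] := mI; exact. Qed.

Lemma mean_le {f g} : bmeas f -> bmeas g -> (forall x, f x <= g x) -> I f <= I g.
Proof.
move=> bf bg fg; rewrite -subr_ge0 -meanB//; apply: mean_ge0; first exact: bmeasB.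
by move=> x; rewrite subr_ge0.
Qed.

Lemma mean_norm {f} {b : R} : bmeas f -> (forall x, `|f x| <= b) -> `|I f| <= b.
Proof.
move=> bf fb; rewrite ler_norml.
have b1 x : - b <= f x by have := fb x; rewrite ler_norml => /andP[].
have b2 x : f x <= b by have := fb x; rewrite ler_norml => /andP[].
by rewrite -{1}(mean_cst (- b)) -{2}(mean_cst b) !mean_le//; exact: bmeas_cst.
Qed.

Lemma mean_sum (n : nat) (F : nat -> T -> R) : (forall i, bmeas (F i)) ->
  I (fun x => \sum_(i < n) F i x) = \sum_(i < n) I (F i).
Proof.
move=> bF; elim: n => [|n IH].
  by under eq_fun do rewrite big_ord0; rewrite big_ord0 mean0.
under eq_fun do rewrite big_ord_recr/=; rewrite big_ord_recr/= meanD ?IH//.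
exact: bmeas_sum.
Qed.

(** An upper bound on the norm instead of the norm: no roots are taken, and measurability and sign
    travel with the bound when bounds are combined. *)
Definition L2bound f b := [/\ bmeas f, 0 <= b & I (fun x => f x ^+ 2) <= b ^+ 2].
Definition L4bound f b := [/\ bmeas f, 0 <= b & I (fun x => f x ^+ 4) <= b ^+ 4].

(** Reduces each L^4 estimate to an L^2 estimate on squares, so that Cauchy-Schwarz is the only
    inequality of its kind needed. *)
Lemma L4bound_sqr f b : bmeas f -> 0 <= b ->
  L2bound (fun x => f x ^+ 2) (b ^+ 2) <-> L4bound f b.
Proof.
move=> bf b0; have E : (fun x => (f x ^+ 2) ^+ 2) = (fun x => f x ^+ 4).
  by apply/funext => x; rewrite -exprM.
rewrite /L2bound /L4bound E -exprM; split => -[_ _ h]; split => //.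
- exact: bmeasX.
- by rewrite exprn_ge0.
Qed.

Lemma mean_cauchy_schwarz {f g a b} : L2bound f a -> L2bound g b ->
  `|I (fun x => f x * g x)| <= a * b.
Proof.
wlog suff : g / L2bound f a -> L2bound g b -> I (fun x => f x * g x) <= a * b.
  move=> H hf hg; rewrite ler_norml H// andbT lerNl.
  have [bf _ _] := hf; have [bg b0 hg2] := hg.
  rewrite -mulN1r -meanZ; last exact: bmeasM.
  have -> : (fun x => -1 * (f x * g x)) = (fun x => f x * - g x).
    by apply/funext => x; ring.
  apply: H => //; split => //; first exact: bmeasN.
  by under eq_fun do rewrite sqrrN.
move=> [bf a0 fa] [bg b0 gb].
(* Integrated form of (s f - t g)^2 >= 0 with free parameters; s = b, t = a gives the claim after
   division by 2 a b. *)
have H s t : 2 * s * t * I (fun x => f x * g x) <= s ^+ 2 * a ^+ 2 + t ^+ 2 * b ^+ 2.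
  apply: (@le_trans _ _ (I (fun x => s ^+ 2 * f x ^+ 2 + t ^+ 2 * g x ^+ 2))).
    rewrite -meanZ; last exact: bmeasM.
    apply: mean_le.
    - by apply: bmeasZ; exact: bmeasM.
    - by apply: bmeasD; apply: bmeasZ; exact: bmeasX.
    - by move=> x; have := sqr_ge0 (s * f x - t * g x); nra.
  rewrite meanD; [|by apply: bmeasZ; exact: bmeasX..].
  rewrite !meanZ; [|exact: bmeasX..].
  by apply: lerD; apply: ler_wpM2l => //; exact: sqr_ge0.
move: (I _) H => z H; rewrite leNgt; apply/negP => abz.
have z0 : 0 < z by apply: le_lt_trans abz; exact: mulr_ge0.
(* When a or b vanishes the optimal choice degenerates. For a = 0, taking s = b^2 + 1 and t = z
   gives 2 (b^2 + 1) z^2 <= b^2 z^2, absurd for z > 0; the case b = 0 is symmetric. *)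
have [a00|a_neq0] := eqVneq a 0.
  have := H (b ^+ 2 + 1) z; rewrite a00.
  have := sqr_ge0 b; move: (b ^+ 2) => c c0.
  have z2 : 0 < z ^+ 2 by rewrite exprn_gt0.
  by nra.
have [b00|b_neq0] := eqVneq b 0.
  have := H z (a ^+ 2 + 1); rewrite b00.
  have := sqr_ge0 a; move: (a ^+ 2) => c c0.
  have z2 : 0 < z ^+ 2 by rewrite exprn_gt0.
  by nra.
have ap : 0 < a by rewrite lt_neqAle eq_sym a_neq0.
have bp : 0 < b by rewrite lt_neqAle eq_sym b_neq0.
have := H b a; have ab := mulr_gt0 ap bp; nra.
Qed.

Lemma L2boundM {f g a b} : L4bound f a -> L4bound g b -> L2bound (fun x => f x * g x) (a * b).
Proof.
move=> hf hg; have [bf a0 _] := hf; have [bg b0 _] := hg.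
split; [exact: bmeasM | exact: mulr_ge0 |].
have := mean_cauchy_schwarz ((L4bound_sqr _ _ bf a0).2 hf) ((L4bound_sqr _ _ bg b0).2 hg).
under eq_fun do rewrite -exprMn; rewrite -exprMn; apply: le_trans; exact: ler_norm.
Qed.

Lemma L2boundD {f g a b} : L2bound f a -> L2bound g b -> L2bound (fun x => f x + g x) (a + b).
Proof.
move=> hf hg; have [bf a0 fa] := hf; have [bg b0 gb] := hg.
split; [exact: bmeasD | exact: addr_ge0 |].
have /(le_trans (ler_norm _)) := mean_cauchy_schwarz hf hg.
under [in X in _ -> X]eq_fun do rewrite sqrrD -mulr_natl.
rewrite meanD; [|by apply: bmeasD; [exact: bmeasX|apply: bmeasZ; exact: bmeasM]|exact: bmeasX].
rewrite meanD; [|exact: bmeasX|by apply: bmeasZ; exact: bmeasM].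
rewrite meanZ; last exact: bmeasM.
lra.
Qed.

Lemma L2bound_dom {f g b} : bmeas f -> (forall x, `|f x| <= `|g x|) -> L2bound g b -> L2bound f b.
Proof.
move=> bf fg [bg b0 gb]; split=> //; apply: le_trans gb.
apply: mean_le; [exact: bmeasX..|move=> x].
by rewrite -(real_normK (num_real (f x))) -(real_normK (num_real (g x))) lerXn2r ?nnegrE.
Qed.

Lemma L4bound_dom {f g b} : bmeas f -> (forall x, `|f x| <= `|g x|) -> L4bound g b -> L4bound f b.
Proof.
move=> bf fg hg; have [bg b0 _] := hg; apply/L4bound_sqr => //.
apply: L2bound_dom ((L4bound_sqr _ _ bg b0).2 hg); first exact: bmeasX.
by move=> x; rewrite !normrX lerXn2r ?nnegrE.
Qed.

Lemma L2boundZ k {f b} : L2bound f b -> L2bound (fun x => k * f x) (`|k| * b).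
Proof.
move=> [bf b0 fb]; split; [exact: bmeasZ | exact: mulr_ge0 |].
under eq_fun do rewrite exprMn; rewrite meanZ; last exact: bmeasX.
by rewrite exprMn real_normK ?num_real// ler_wpM2l// sqr_ge0.
Qed.

Lemma L4boundZ k {f b} : L4bound f b -> L4bound (fun x => k * f x) (`|k| * b).
Proof.
move=> hf; have [bf b0 _] := hf.
apply/L4bound_sqr; [exact: bmeasZ | exact: mulr_ge0 |].
have := L2boundZ (k ^+ 2) ((L4bound_sqr _ _ bf b0).2 hf).
by under eq_fun do rewrite -exprMn; rewrite normrX -exprMn.
Qed.

(** Minkowski in L^4 from Minkowski in L^2 applied to the three terms of (f + g)^2, the cross term
    being controlled by [L2boundM]. *)
Lemma L4boundD {f g a b} : L4bound f a -> L4bound g b -> L4bound (fun x => f x + g x) (a + b).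
Proof.
move=> hf hg; have [bf a0 _] := hf; have [bg b0 _] := hg.
apply/L4bound_sqr; [exact: bmeasD | exact: addr_ge0 |].
have Hf := (L4bound_sqr _ _ bf a0).2 hf; have Hg := (L4bound_sqr _ _ bg b0).2 hg.
have H := L2boundD (L2boundD Hf (L2boundZ 2 (L2boundM hf hg))) Hg.
have -> : (a + b) ^+ 2 = a ^+ 2 + `|2| * (a * b) + b ^+ 2 by rewrite ger0_norm//; ring.
by rewrite (_ : (fun x => _) = (fun x => f x ^+ 2 + 2 * (f x * g x) + g x ^+ 2))//;
  apply/funext => x; ring.
Qed.

Lemma L2bound_le {f a b} : a <= b -> L2bound f a -> L2bound f b.
Proof.
move=> ab [bf a0 fa]; have b0 := le_trans a0 ab.
by split=> //; apply: le_trans fa _; rewrite lerXn2r ?nnegrE.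
Qed.

Lemma L4bound_le {f a b} : a <= b -> L4bound f a -> L4bound f b.
Proof.
move=> ab [bf a0 fa]; have b0 := le_trans a0 ab.
by split=> //; apply: le_trans fa _; rewrite lerXn2r ?nnegrE.
Qed.
Lemma L4bound_bmeas {f b} : L4bound f b -> bmeas f. Proof. by case. Qed.
Lemma L2bound_ge0 {f b} : L2bound f b -> 0 <= b. Proof. by case. Qed.
Lemma L2bound_bmeas {f b} : L2bound f b -> bmeas f. Proof. by case. Qed.

Lemma L4bound_sum (n : nat) (F : nat -> T -> R) (b : nat -> R) :
  (forall i, (i < n)%N -> L4bound (F i) (b i)) ->
  L4bound (fun x => \sum_(0 <= i < n) F i x) (\sum_(0 <= i < n) b i).
Proof.
elim: n => [|n IH] H.
  rewrite big_nil; under eq_fun do rewrite big_nil.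
  split=> //; first exact: bmeas_cst.
  by under eq_fun do rewrite expr0n; rewrite mean0 expr0n.
rewrite big_nat_recr//=; under eq_fun do rewrite big_nat_recr//=.
by apply: L4boundD; [apply: IH => i ? ; apply: H; exact: ltnW | exact: H].
Qed.

Lemma L4_L2bound {f b} : L4bound f b -> L2bound f b.
Proof.
move=> hf; have [bf b0 _] := hf; split => //.
have L1 : L2bound (fun=> 1) 1 by split => //; [exact: bmeas_cst | rewrite mean_cst].
have := mean_cauchy_schwarz ((L4bound_sqr _ _ bf b0).2 hf) L1.
under eq_fun do rewrite mulr1; rewrite mulr1; apply: le_trans; exact: ler_norm.
Qed.

(** Measurability is proved together with the bound because the terms are controlled only for
    indices in the range, as happens for levels below L. *)
Lemma mean_norm_sum {m n : nat} {F : nat -> T -> R} {b : nat -> R} :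
  (forall i, (m <= i < n)%N -> bmeas (F i) /\ `|I (F i)| <= b i) ->
  bmeas (fun x => \sum_(m <= i < n) F i x) /\
  `|I (fun x => \sum_(m <= i < n) F i x)| <= \sum_(m <= i < n) b i.
Proof.
have [nm _|mn] := leqP n m.
  under eq_fun do rewrite big_geq//; rewrite mean0 normr0 big_geq//.
  by split=> //; exact: bmeas_cst.
elim: n mn => [//|n IH]; rewrite ltnS => mn H.
have [bn Hn] : bmeas (F n) /\ `|I (F n)| <= b n by apply: H; rewrite mn ltnSn.
have [bS HS] : bmeas (fun x => \sum_(m <= i < n) F i x) /\
    `|I (fun x => \sum_(m <= i < n) F i x)| <= \sum_(m <= i < n) b i.
  have [nm|{}mn] := leqP n m.
    under eq_fun do rewrite big_geq//; rewrite mean0 normr0 big_geq//.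
    by split=> //; exact: bmeas_cst.
  by apply: IH => // i /andP[mi i_n]; apply: H; rewrite mi ltnW.
under eq_fun do rewrite big_nat_recr//=; rewrite big_nat_recr//=.
split; first exact: bmeasD.
by rewrite meanD//; apply: le_trans (ler_normD _ _) (lerD HS Hn).
Qed.

End Means.
Arguments L2bound {R d T} I f b.
Arguments L4bound {R d T} I f b.

(** * Integrals of bounded functions against an integrable weight *)

Section WeightedIntegral.
Context {R : realType} {d : measure_display} {T : measurableType d}.
Context {mu : {measure set T -> \bar R}} {w : T -> R}.
Context (w0 : forall x, 0 <= w x) (iw : mu.-integrable setT (EFin \o w)).

Lemma wint_integrable {f} : bmeas f -> mu.-integrable setT (EFin \o (fun x => f x * w x)).
Proof.
move=> [mf [b fb]]; have mw : measurable_fun setT w by exact/measurable_EFinP/(measurable_int _ iw).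
apply: (@le_integrable _ _ _ mu setT measurableT _ (fun x => b%:E * (EFin \o w) x)%E).
- by apply/measurable_EFinP; exact: measurable_funM.
- move=> x _ /=; rewrite lee_fin normrM (ger0_norm (w0 x)).
  rewrite normrM (ger0_norm (w0 x)) ler_wpM2r//.
  by apply: le_trans (fb x) _; exact: ler_norm.
- exact: integrableZl.
Qed.

Lemma wint_EFin {f} : bmeas f ->
  (fine (\int[mu]_x (f x * w x)%:E))%:E = (\int[mu]_x (f x * w x)%:E)%E.
Proof. by move=> bf; rewrite fineK//; exact: integrable_fin_num (wint_integrable bf). Qed.

Lemma wint_lin a f g : bmeas f -> bmeas g ->
  fine (\int[mu]_x ((a * f x + g x) * w x)%:E) =
  a * fine (\int[mu]_x (f x * w x)%:E) + fine (\int[mu]_x (g x * w x)%:E).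
Proof.
move=> bf bg; apply: EFin_inj; rewrite EFinD EFinM !wint_EFin//; last exact: bmeas_lin.
under eq_integral => x _ do rewrite mulrDl EFinD -mulrA EFinM.
rewrite integralD//; [|exact: integrableZl (wint_integrable bf)|exact: wint_integrable].
by rewrite integralZl//; exact: (wint_integrable bf).
Qed.

Lemma wint_ge0 f : (forall x, 0 <= f x) -> 0 <= fine (\int[mu]_x (f x * w x)%:E).
Proof.
by move=> f0; apply/fine_ge0/integral_ge0 => x _; rewrite lee_fin mulr_ge0.
Qed.

Lemma wint_lim : bcontinuous (fun f : T -> R => fine (\int[mu]_x (f x * w x)%:E)).
Proof.
move=> F f c bF Fc Ff; have bf := bmeas_lim F f c bF Fc Ff.
have mF g : bmeas g -> measurable_fun setT (fun x => (g x * w x)%:E).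
  by move=> bg; exact: measurable_int (wint_integrable bg).
have Fw x : (F n x * w x)%:E @[n --> \oo] --> (f x * w x)%:E.
  apply: cvg_EFin; first exact: nearW.
  by apply: cvgM; [exact: Ff | exact: cvg_cst].
have Fcw n x : (`|(F n x * w x)%:E| <= c%:E * (EFin \o w) x)%E.
  by rewrite lee_fin normrM (ger0_norm (w0 x)) ler_wpM2r.
have [_ _ cv] := dominated_convergence measurableT (fun n => mF _ (bF n)) (mF _ bf)
  (aeW mu (fun x _ => Fw x)) (integrableZl measurableT c iw) (aeW mu (fun x n _ => Fcw n x)).
by apply: fine_cvg; rewrite wint_EFin.
Qed.

Lemma wint_mean : fine (\int[mu]_x (w x)%:E) != 0 ->
  mean (fun f : T -> R => fine (\int[mu]_x (f x * w x)%:E) / fine (\int[mu]_x (w x)%:E)).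
Proof.
move=> W0; split => [|a f g bf bg|f bf f0].
- by under eq_integral do rewrite mul1r; rewrite divff.
- by rewrite wint_lin// mulrDl mulrA.
- rewrite divr_ge0 ?wint_ge0//; apply/fine_ge0/integral_ge0 => x _.
  by rewrite lee_fin.
Qed.

End WeightedIntegral.

(** * Integrals against a probability *)

Section ProbabilityIntegral.
Context {R : realType} {d : measure_display} {T : measurableType d}.
Context {P : {measure set T -> \bar R}} (P1 : P setT = 1%E).

Let iw : P.-integrable setT (EFin \o (fun _ : T => 1 : R)).
Proof.
apply/integrableP; split; first exact: measurable_cst.
rewrite (_ : (fun x => _) = cst 1%E); last by apply/funext => x /=; rewrite normr1.
by rewrite integral_cst// P1 mule1 ltry.
Qed.

Let w0 (x : T) : 0 <= 1 :> R. Proof. by []. Qed.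

(** A probability is treated as the case of constant weight 1 of the weighted integrals. *)
Lemma integral_mul1 (f : T -> R) :
  fine (\int[P]_x (f x)%:E) = fine (\int[P]_x (f x * 1)%:E).
Proof. by under [in RHS]eq_integral do rewrite mulr1. Qed.

Lemma integral_mean : mean (fun f : T -> R => fine (\int[P]_x (f x)%:E)).
Proof.
have i1 : fine (\int[P]_x (1 : R)%:E) = 1 by rewrite integral_cst// P1 mule1.
have := @wint_mean _ _ _ P _ w0 iw; rewrite i1 => /(_ (oner_neq0 _)).
by rewrite (_ : (fun f : T -> R => _) = (fun f : T -> R => fine (\int[P]_x (f x)%:E)))//;
  apply/funext => f; rewrite divr1 -integral_mul1.
Qed.

Lemma integral_bcontinuous : bcontinuous (fun f : T -> R => fine (\int[P]_x (f x)%:E)).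
Proof.
have := @wint_lim _ _ _ P _ w0 iw.
rewrite (_ : (fun f : T -> R => _) = (fun f : T -> R => fine (\int[P]_x (f x)%:E)))//.
by apply/funext => f; rewrite -integral_mul1.
Qed.

Lemma integral_EFin {f} : bmeas f -> (fine (\int[P]_x (f x)%:E))%:E = (\int[P]_x (f x)%:E)%E.
Proof.
by move=> /(wint_EFin w0 iw); under eq_integral do rewrite mulr1.
Qed.

End ProbabilityIntegral.

(** * Markov kernels and the measures eta_l acting on bounded functions *)

Section Kernels.
Context {R : realType} {d : measure_display} {E : measurableType d}.
Context {M : nat -> R.-pker E ~> E}.

Lemma kapply_mean l u : mean (fun f => kapply M l f u).
Proof. exact: (@integral_mean _ _ _ (M l u) (@prob_kernel _ _ _ _ _ (M l) u)). Qed.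

Lemma kapply_bcontinuous l u : bcontinuous (fun f => kapply M l f u).
Proof. exact: (@integral_bcontinuous _ _ _ (M l u) (@prob_kernel _ _ _ _ _ (M l) u)). Qed.

Lemma kapply_indic l A u : measurable A -> kapply M l \1_A u = fine (M l u A).
Proof. by move=> mA; rewrite /kapply integral_indic// setIT. Qed.

(** A kernel is measurable in its starting point for each fixed set, which settles indicators;
    linearity and bounded convergence do the rest. *)
Lemma kapply_bmeas l {f} : bmeas f -> bmeas (kapply M l f).
Proof.
move=> /[dup] [] [_ [b fb]] bf; split; last first.
  by exists b => u; exact: (mean_norm (kapply_mean l u)).
elim: (bmeas_bclosure_indic _ bf) => {f b fb bf} [f [A mA ->]|a f g cf mf cg mg|F f c cF mF Fc Ff].
- rewrite (_ : kapply M l _ = fun u => fine (M l u A)); last first.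
    by apply/funext => u; rewrite kapply_indic.
  by apply: measurableT_comp; [exact: fine_measurable | exact: measurable_kernel].
- have bf := bclosure_bmeas indicator_bmeas cf; have bg := bclosure_bmeas indicator_bmeas cg.
  rewrite (_ : kapply M l _ = fun u => a * kapply M l f u + kapply M l g u).
    by apply: measurable_funD => //; apply: measurable_funM => //; exact: measurable_cst.
  by apply/funext => u; have [_ L _] := kapply_mean l u; rewrite L.
- have bF n := bclosure_bmeas indicator_bmeas (cF n).
  apply: (@measurable_fun_cvg _ _ _ setT (fun n => kapply M l (F n))) => // u _.
  exact: (kapply_bcontinuous l u F f c).
Qed.

(** Carries (A2) from sets to nonnegative functions, by comparing integrals against the scaled
    measure rho M(v, .) and against M(u, .). *)
Lemma kapply_minorized l rho f u v : 0 < rho ->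
  (forall A, measurable A -> (rho%:E * M l v A <= M l u A)%E) ->
  bmeas f -> (forall x, 0 <= f x) -> rho * kapply M l f v <= kapply M l f u.
Proof.
move=> rho0 H bf f0; rewrite -lee_fin EFinM /kapply.
rewrite (@integral_EFin _ _ _ (M l v))// ?(@integral_EFin _ _ _ (M l u))//; try exact: prob_kernel.
have [mf _] := bf.
have := @ge0_integral_mscale _ _ _ (M l v) setT measurableT (NngNum (ltW rho0)) (EFin \o f).
move=> /= <-; [|exact/measurable_EFinP|by move=> x _; rewrite lee_fin].
apply: ge0_le_measure_integral => //; last exact/measurable_EFinP.
Qed.

Context {mu : {measure set E -> \bar R}} {gam : nat -> E -> R}.
Context (gam_meas : forall l, measurable_fun [set: E] (gam l)).
Context (gam_pos : forall l u, 0 < gam l u).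
Context (Z_fin : forall l, (\int[mu]_u (gam l u)%:E < +oo)%E).
Context (Z_pos : forall l, (0 < \int[mu]_u (gam l u)%:E)%E).

Let gam_ge0 l u : 0 <= gam l u. Proof. exact: ltW. Qed.

Let gam_int l : mu.-integrable setT (EFin \o gam l).
Proof.
apply/integrableP; split; first exact/measurable_EFinP.
by under eq_integral do rewrite /= ger0_norm//.
Qed.

Lemma Zc_gt0 l : 0 < Zc mu gam l.
Proof. by rewrite /Zc fine_gt0// Z_pos Z_fin. Qed.

Lemma eta_mean l : mean (eta_ mu gam l).
Proof. by apply: wint_mean => //; rewrite gt_eqF// Zc_gt0. Qed.

Lemma eta_bcontinuous l : bcontinuous (eta_ mu gam l).
Proof.
move=> F f c bF Fc Ff; apply: cvgM; last exact: cvg_cst.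
exact: (wint_lim (gam_ge0 l) (gam_int l) F f c).
Qed.

(** Since G_l gamma_l = gamma_(l+1), reweighting by G_l turns eta_l into eta_(l+1) up to the ratio
    of normalising constants. *)
Lemma eta_Gp l f : eta_ mu gam l (fun u => f u * Gp gam l u) =
  Zc mu gam l.+1 / Zc mu gam l * eta_ mu gam l.+1 f.
Proof.
rewrite /eta_; have -> : (fun u => (f u * Gp gam l u * gam l u)%:E) = (fun u => (f u * gam l.+1 u)%:E).
  by apply/funext => u; rewrite /Gp -mulrA divfK// gt_eqF.
have := Zc_gt0 l; have := Zc_gt0 l.+1 => z1 z0; field; rewrite !gt_eqF//.
Qed.

Context (M_inv : forall l, (1 <= l)%N -> forall A, measurable A ->
     (\int[mu]_u (M l u A * (gam l u / Zc mu gam l)%:E) =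
      \int[mu]_(u in A) (gam l u / Zc mu gam l)%:E)%E).

Lemma eta_kapply l f : (1 <= l)%N -> bmeas f -> eta_ mu gam l (kapply M l f) = eta_ mu gam l f.
Proof.
move=> l1 bf.
elim: (bmeas_bclosure_indic _ bf) => {f bf} [f [A mA ->]|a f g cf If cg Ig|F f c cF IF Fc Ff].
- have bA : bmeas (\1_A : E -> R) by apply: indicator_bmeas; exists A.
  have zZ : (Zc mu gam l)^-1 != 0 by rewrite invr_eq0 gt_eqF// Zc_gt0.
  have MA u : M l u A = (kapply M l \1_A u)%:E.
    rewrite kapply_indic// fineK// ge0_fin_numE//.
    apply: (@le_lt_trans _ _ (M l u setT)); last by rewrite prob_kernel ltry.
    by apply: le_measure; rewrite ?inE.
  (* In [M_inv] the factor 1 / Z_l sits inside both integrals; it is extracted on each side and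
     cancelled. *)
  have := M_inv l l1 A mA; rewrite [RHS]integral_mkcond.
  under eq_integral => u _.
    rewrite MA -EFinM mulrA mulrC EFinM.
    over.
  under [RHS]eq_integral => u _.
    rewrite (_ : _ u = ((Zc mu gam l)^-1%:E * (\1_A u * gam l u)%:E)%E); last first.
      by rewrite patchE indicE; case: ifPn => _; rewrite ?mul1r ?mul0r ?mule0// -EFinM mulrC.
    over.
  have bK := kapply_bmeas l bA.
  rewrite !integralZl//; try exact: (wint_integrable (gam_ge0 l) (gam_int l)).
  rewrite -(wint_EFin (gam_ge0 l) (gam_int l) bK) -(wint_EFin (gam_ge0 l) (gam_int l) bA).
  by move=> [] /(mulfI zZ); rewrite /eta_ => ->.
- have bf := bclosure_bmeas indicator_bmeas cf; have bg := bclosure_bmeas indicator_bmeas cg.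
  have [_ L _] := eta_mean l; rewrite L// -If -Ig -L; [|exact: kapply_bmeas..].
  by congr (eta_ _ _ _ _); apply/funext => u; have [_ K _] := kapply_mean l u; rewrite K.
- have bF n := bclosure_bmeas indicator_bmeas (cF n).
  have := eta_bcontinuous l F f c bF Fc Ff.
  rewrite (_ : (fun n => _) = (fun n => eta_ mu gam l (kapply M l (F n)))); last first.
    by apply/funext => n; rewrite IF.
  move=> /cvg_lim <- //; apply/esym/cvg_lim => //.
  apply: (eta_bcontinuous l _ _ c) => [n|n u|u].
  + exact: kapply_bmeas.
  + exact: (mean_norm (kapply_mean l u)).
  + exact: (kapply_bcontinuous l u F f c).
Qed.

End Kernels.

(** * Stability of the Feynman-Kac semigroup *)

Section FeynmanKac.
Context {R : realType} {d : measure_display} {E : measurableType d}.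
Context {M : nat -> R.-pker E ~> E} {gam : nat -> E -> R}.
Context (gam_meas : forall l, measurable_fun [set: E] (gam l)).
Context (gam_pos : forall l u, 0 < gam l u).

(** The unnormalised Feynman-Kac semigroup from time s to time s + k. *)
Fixpoint FK (k s : nat) (f : E -> R) : E -> R :=
  if k is k'.+1 then fun u => Gp gam s u * kapply M s.+1 (FK k' s.+1 f) u else f.

Lemma Gp_gt0 l u : 0 < Gp gam l u.
Proof. by rewrite divr_gt0. Qed.

Lemma Gp_meas l : measurable_fun setT (Gp gam l).
Proof.
rewrite (_ : Gp gam l = expR \o (fun u => ln (gam l.+1 u) - ln (gam l u))).
  apply: measurableT_comp; first exact: measurable_expR.
  by apply: measurable_funB; apply: measurableT_comp => //; exact: measurable_ln.
by apply/funext => u; rewrite /= expRD expRN !lnK// posrE.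
Qed.

Context {Cl Cu : R} (Cl0 : 0 < Cl) (ClCu : Cl < Cu).
Context (A1 : forall l u, (1 <= l)%N -> Cl <= Gp gam l u <= Cu).
Context {rho : R} (Hrho : 0 < rho < 1).
Context (A2 : forall l, (1 <= l)%N -> forall u v A, measurable A ->
     (rho%:E * M l v A <= M l u A)%E).

Lemma Gp_bmeas l : (1 <= l)%N -> bmeas (Gp gam l).
Proof.
move=> l1; split; first exact: Gp_meas.
by exists Cu => u; rewrite gtr0_norm ?Gp_gt0//; have /andP[] := A1 l u l1.
Qed.

Lemma FK_bmeas k s {f} : (1 <= s)%N -> bmeas f -> bmeas (FK k s f).
Proof.
elim: k s => [//|k IH] s s1 bf /=.
by apply: bmeasM; [exact: Gp_bmeas | apply: kapply_bmeas; exact: IH].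
Qed.

Notation q k s := (FK k s (fun=> 1)).

Lemma FK1_bmeas k s : (1 <= s)%N -> bmeas (q k s).
Proof. by move=> s1; apply: FK_bmeas => //; exact: bmeas_cst. Qed.

(** A constant lower bound, unlike pointwise positivity, survives every mean; its dependence on k is
    harmless, as it only justifies divisions. *)
Lemma FK1_lower k s : (1 <= s)%N -> exists2 e : R, 0 < e & forall u, e <= q k s u.
Proof.
elim: k s => [|k IH] s s1 /=; first by exists 1.
have [e e0 qe] := IH s.+1 isT; exists (Cl * e); first exact: mulr_gt0.
move=> u; apply: ler_pM; [exact: ltW|exact: ltW| |]; first by have /andP[] := A1 s u s1.
have mK := @kapply_mean _ _ _ M s.+1 u.
by rewrite -(mean_cst mK e) (mean_le mK)//; [exact: bmeas_cst | exact: FK1_bmeas].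
Qed.

Lemma FK1_gt0 k s u : (1 <= s)%N -> 0 < q k s u.
Proof. by move=> s1; have [e e0 /(_ u)] := FK1_lower k s s1; exact: lt_le_trans. Qed.

Lemma kapply_gt0 l {f : E -> R} {e : R} u : bmeas f -> 0 < e -> (forall v, e <= f v) ->
  0 < kapply M l f u.
Proof.
move=> bf e0 ef; apply: (lt_le_trans e0); have mK := @kapply_mean _ _ _ M l u.
by rewrite -(mean_cst mK e) (mean_le mK)//; exact: bmeas_cst.
Qed.

Definition kappa := 1 - rho ^+ 2.
(** The factor Cu / Cl accounts for the oscillation of the first weight, 1 / rho for that of the
    kernel after it. *)
Definition Bq := Cu / (Cl * rho).

Lemma kappa_gt0 : 0 < kappa.
Proof. by case/andP: Hrho => ? ?; rewrite /kappa; nra. Qed.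

Lemma kappa_lt1 : kappa < 1.
Proof. by case/andP: Hrho => ? ?; rewrite /kappa; nra. Qed.

Lemma Bq_ge1 : 1 <= Bq.
Proof. by case/andP: Hrho => ? ?; rewrite /Bq ler_pdivlMr ?mulr_gt0// mul1r (le_trans _ (ltW ClCu))// ger_pMr// ltW. Qed.

(** The starting point enters only through the weight and the kernel of the first step, whence a
    constant independent of k. *)
Lemma FK1_harnack k s u v : (1 <= s)%N -> q k s u <= Bq * q k s v.
Proof.
case: k => [|k] s1 /=; first by rewrite mulr1 Bq_ge1.
have [r0 r1] := andP Hrho.
have bq := FK1_bmeas k s.+1 isT; have [e e0 qe] := FK1_lower k s.+1 isT.
have := kapply_minorized s.+1 rho _ v u r0 (fun A => A2 s.+1 isT v u A) bq
  (fun x => ltW (FK1_gt0 k s.+1 x isT)).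
have := kapply_gt0 s.+1 u bq e0 qe; have := kapply_gt0 s.+1 v bq e0 qe.
have /andP[_ Gu] := A1 s u s1; have /andP[Gv _] := A1 s v s1.
move: (kapply _ _ _ u) (kapply _ _ _ v) => ku kv kv0 ku0 kuv.
apply: (@le_trans _ _ (Cu * ku)); first by rewrite ler_wpM2r// ltW.
rewrite /Bq -mulrA ler_wpM2l//; first by rewrite ltW// (lt_trans Cl0).
rewrite mulrC ler_pdivlMr ?mulr_gt0//.
by rewrite mulrCA (mulrC ku); apply: ler_pM => //; [exact: ltW | rewrite mulr_ge0// ltW].
Qed.

(* Doeblin: comparing the two-sided bounds at x with the value t of the ratio at a fixed
   y0 shrinks the interval containing h / q by the factor 1 - rho^2. *)
Lemma FK_contraction (y0 : E) k s f b : (1 <= s)%N -> bmeas f -> (forall u, `|f u| <= b) ->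
  exists m, forall u, m * q k s u <= FK k s f u <= (m + 2 * b * kappa ^+ k) * q k s u.
Proof.
elim: k s => [|k IH] s s1 bf fb /=.
  exists (- b) => u; rewrite expr0 !mulr1; have := fb u; rewrite ler_norml => /andP[? ?].
  by apply/andP; split; lra.
have [m hm] := IH s.+1 isT bf fb.
set dl := 2 * b * kappa ^+ k in hm.
have [r0 r1] := andP Hrho.
have bq := FK1_bmeas k s.+1 isT; have [e e0 qe] := FK1_lower k s.+1 isT.
have bh := FK_bmeas k s.+1 isT bf.
set h' := FK k s.+1 f in hm bh *; set q' := q k s.+1 in hm bq qe *.
pose a := kapply M s.+1 h'; pose p := kapply M s.+1 q'.
have p0 x : 0 < p x by exact: kapply_gt0 bq e0 qe.
have q0 x : 0 <= q' x by rewrite (le_trans (ltW e0)).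
have KB c x : kapply M s.+1 (fun u => h' u - c * q' u) x = a x - c * p x.
  by rewrite (meanB (kapply_mean _ x))//; [rewrite (meanZ (kapply_mean _ x))|exact: bmeasZ].
have KC c x : kapply M s.+1 (fun u => c * q' u - h' u) x = c * p x - a x.
  by rewrite (meanB (kapply_mean _ x))//; [rewrite (meanZ (kapply_mean _ x))|exact: bmeasZ].
have P x y : rho * p x <= p y.
  exact: (kapply_minorized s.+1 rho _ y x r0 (fun A => A2 s.+1 isT y x A) bq q0).
have L0 u : 0 <= h' u - m * q' u by rewrite subr_ge0; case/andP: (hm u).
have U0 u : 0 <= (m + dl) * q' u - h' u by rewrite subr_ge0; case/andP: (hm u).
have L x y : rho * (a x - m * p x) <= a y - m * p y.
  have := kapply_minorized s.+1 rho _ y x r0 (fun A => A2 s.+1 isT y x A)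
    (bmeasB bh (bmeasZ m bq)) L0.
  by rewrite !KB.
have U x y : rho * ((m + dl) * p x - a x) <= (m + dl) * p y - a y.
  have := kapply_minorized s.+1 rho _ y x r0 (fun A => A2 s.+1 isT y x A)
    (bmeasB (bmeasZ (m + dl) bq) bh) U0.
  by rewrite !KC.
pose t := a y0 / p y0 - m.
have at_ : a y0 = (m + t) * p y0 by rewrite /t addrC subrK divfK// gt_eqF.
have t0 : 0 <= t.
  have : 0 <= a y0 - m * p y0.
    by rewrite -KB; apply: (mean_ge0 (kapply_mean _ y0)) => //; apply: bmeasB => //; exact: bmeasZ.
  by rewrite at_ -mulrBl addrAC subrr add0r pmulr_lge0.
have t1 : 0 <= dl - t.
  have : 0 <= (m + dl) * p y0 - a y0.
    by rewrite -KC; apply: (mean_ge0 (kapply_mean _ y0)) => //; apply: bmeasB => //; exact: bmeasZ.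
  by rewrite at_ -mulrBl pmulr_lge0// => ?; lra.
(* One factor rho comes from comparing the numerators at u and y0, the other from comparing the
   denominators. The lower end rises by rho^2 t and the upper end falls by rho^2 (dl - t): the total
   gain rho^2 dl does not depend on t. *)
exists (m + rho ^+ 2 * t) => u; rewrite -/(a u) -/(p u).
have -> : 2 * b * kappa ^+ k.+1 = (1 - rho ^+ 2) * dl by rewrite /dl exprS /kappa; ring.
have Lu := L y0 u; have Uu := U y0 u; have Pu := P u y0.
have G0 := ltW (Gp_gt0 s u).
have H1 : rho * t * (rho * p u) <= rho * t * p y0 by rewrite ler_wpM2l// mulr_ge0// ltW.
have H2 : rho * (dl - t) * (rho * p u) <= rho * (dl - t) * p y0 by rewrite ler_wpM2l// mulr_ge0// ltW.
rewrite !(mulrCA _ (Gp gam s u)); apply/andP; split; rewrite ler_wpM2l//.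
  by rewrite at_ in Lu; nra.
by rewrite at_ in Uu; nra.
Qed.

(** Subtracting m q leaves a nonnegative numerator of relative size kappa^k, and dividing by q(y0)
    puts the denominator in a range uniform in k. The same m works for every mean, so it disappears
    from the difference of two ratios. *)
Lemma FK_normalize (y0 : E) k s f b : (1 <= s)%N -> bmeas f -> (forall u, `|f u| <= b) ->
  exists m phi psi, [/\ bmeas phi, bmeas psi,
    (forall u, Bq^-1 <= psi u <= Bq),
    (forall u, 0 <= phi u <= 2 * b * kappa ^+ k * psi u) &
    forall I, mean I -> I (FK k s f) / I (q k s) = m + I phi / I psi].
Proof.
move=> s1 bf fb; have [m hm] := FK_contraction y0 k s f b s1 bf fb.
have q00 := FK1_gt0 k s y0 s1; have bq := FK1_bmeas k s s1.
set q0 := q k s y0 in q00.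
exists m, (fun u => q0^-1 * (FK k s f u - m * q k s u)), (fun u => q0^-1 * q k s u).
have B0 : 0 < Bq by rewrite (lt_le_trans _ Bq_ge1).
split.
- by apply: bmeasZ; apply: bmeasB; [exact: FK_bmeas | exact: bmeasZ].
- exact: bmeasZ.
- move=> u; apply/andP; split.
    rewrite mulrC ler_pdivlMr// mulrC ler_pdivrMr// mulrC.
    exact: FK1_harnack.
  by rewrite mulrC ler_pdivrMr//; exact: FK1_harnack.
- move=> u; have /andP[h1 h2] := hm u; apply/andP; split.
    by rewrite mulr_ge0 ?invr_ge0 ?(ltW q00)// subr_ge0.
  rewrite mulrCA ler_wpM2l ?invr_ge0 ?(ltW q00)// lerBlDl -mulrDl//.
- move=> I mI.
  have [e e0 qe] := FK1_lower k s s1.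
  have Iq : 0 < I (q k s).
    by apply: (lt_le_trans e0); rewrite -(mean_cst mI e) (mean_le mI)//; exact: bmeas_cst.
  rewrite !(meanZ mI)//; last by apply: bmeasB; [exact: FK_bmeas | exact: bmeasZ].
  rewrite (meanB mI); [|exact: FK_bmeas|exact: bmeasZ].
  rewrite (meanZ mI)//; field; rewrite !gt_eqF//.
Qed.

End FeynmanKac.

Arguments kappa {R} rho.
Arguments Bq {R} Cl Cu rho.

(** Replaces the monotone class argument: the set of f orthogonal to A is stable under linear
    combinations and bounded limits. *)
Lemma bclosure_orthogonal {R : realType} {d : measure_display} {T : measurableType d}
    {P : (T -> R) -> Prop} {I : (T -> R) -> R} (A : T -> R) :
  mean I -> bcontinuous I -> (forall f, P f -> bmeas f) -> bmeas A ->
  (forall f, P f -> I (fun x => f x * A x) = 0) ->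
  forall f, bclosure P f -> I (fun x => f x * A x) = 0.
Proof.
move=> mI cI bP bA H f; elim=> [{}f /H //|a {}f g cf If cg Ig|F {}f c cF IF Fc Ff].
- have bf := bclosure_bmeas bP cf; have bg := bclosure_bmeas bP cg.
  rewrite (_ : (fun x => _) = fun x => a * (f x * A x) + g x * A x); last first.
    by apply/funext => x; ring.
  by have [_ K _] := mI; rewrite K ?If ?Ig ?mulr0 ?addr0//; exact: bmeasM.
- have [_ [b Ab]] := bA; have bF n := bclosure_bmeas bP (cF n).
  have := cI (fun n x => F n x * A x) (fun x => f x * A x) (c * b).
  rewrite (_ : (fun n => I _) = (fun=> 0)); last by apply/funext => n.
  move=> H'; apply/esym; suff : (fun=> 0 : R) @ \oo --> I (fun x => f x * A x).
    by move=> /cvg_lim <-//; rewrite lim_cst.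
  apply: H' => [n|n x|x].
  + exact: (bmeasM (bF n) bA).
  + by rewrite normrM; apply: ler_pM.
  + by apply: cvgM; [exact: Ff | exact: cvg_cst].
Qed.

(** * The particle system *)

Section ParticleSystem.
Context {R : realType} {d : measure_display} {E : measurableType d}.
Context {mu : {measure set E -> \bar R}} {gam : nat -> E -> R} {M : nat -> R.-pker E ~> E}.
Context (gam_meas : forall l, measurable_fun [set: E] (gam l)).
Context (gam_pos : forall l u, 0 < gam l u).
Context (Z_fin : forall l, (\int[mu]_u (gam l u)%:E < +oo)%E).
Context (Z_pos : forall l, (0 < \int[mu]_u (gam l u)%:E)%E).

(* Normalised weights: [eta_ l] integrates [Gn l] to 1. *)
Definition Gn l u := Zc mu gam l / Zc mu gam l.+1 * Gp gam l u.
Context {K : R} (Gn_le : forall l u, Gn l u <= K).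
Context {d' : measure_display} {Om : measurableType d'} {P : probability Om R}.
Context {N : nat -> nat} {L : nat} {U : nat -> nat -> Om -> E}.
Context (N_gt0 : forall l, (l < L)%N -> (1 <= N l)%N).
Context (PS : particle_system P mu gam M N L U).

Let Z0 l : 0 < Zc mu gam l. Proof. exact: Zc_gt0. Qed.

Let eta0_mean : mean (eta_ mu gam 0). Proof. exact: eta_mean. Qed.

Lemma Gn_gt0 l u : 0 < Gn l u.
Proof. by rewrite mulr_gt0 ?divr_gt0// Gp_gt0. Qed.

Lemma GpE l u : Gp gam l u = Zc mu gam l.+1 / Zc mu gam l * Gn l u.
Proof. by rewrite /Gn; field; rewrite !gt_eqF. Qed.

Lemma Gn_bmeas l : bmeas (Gn l).
Proof.
split; last by exists K => u; rewrite gtr0_norm// Gn_gt0.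
rewrite (_ : Gn l = cst (Zc mu gam l / Zc mu gam l.+1) \* Gp gam l)//.
apply: (@measurable_funM _ _ _ setT (cst _) (Gp gam l)); first exact: measurable_cst.
exact: (Gp_meas gam_meas gam_pos).
Qed.

Let G_bmeas l : bmeas (Gp gam l).
Proof.
rewrite (_ : Gp gam l = fun u => Zc mu gam l.+1 / Zc mu gam l * Gn l u).
  exact: (bmeasZ _ (Gn_bmeas l)).
by apply/funext => u; exact: GpE.
Qed.

Definition Ex (X : Om -> R) : R := fine (\int[P]_w (X w)%:E).

Lemma Ex_mean : mean Ex.
Proof. exact: (@integral_mean _ _ _ P (probability_setT P)). Qed.

Lemma Ex_bcontinuous : bcontinuous Ex.
Proof. exact: (@integral_bcontinuous _ _ _ P (probability_setT P)). Qed.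

Lemma Ex_EFin {X} : bmeas X -> (Ex X)%:E = (\int[P]_w (X w)%:E)%E.
Proof. exact: (@integral_EFin _ _ _ P (probability_setT P)). Qed.

(* The law of the particles of level s given the earlier levels. *)
Definition smean (s : nat) (f : E -> R) (w : Om) : R :=
  if s is s'.+1 then Phi gam M s (N s') (fun j => U s' j w) f else eta_ mu gam 0 f.

Lemma U_bmeas k j {f : E -> R} : bmeas f -> bmeas (fun w => f (U k j w)).
Proof.
move=> [mf [c fc]]; have [mU _] := PS.
by split; [exact: measurableT_comp | exists c].
Qed.

(** The value s = L is included, because [smean] at s reads only the particles of level s - 1. *)
Lemma smean_mean s w : (s <= L)%N -> mean (fun f => smean s f w).
Proof.
case: s => [_|s sL] //=.
have N0 := N_gt0 s sL.
have S0 : 0 < \sum_(j < N s) Gp gam s (U s j w).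
  move: (N s) N0 => [//|n] _; rewrite big_ord_recl ltr_pwDl ?Gp_gt0//.
  by apply: sumr_ge0 => j _; rewrite ltW// Gp_gt0.
split => [|a f g bf bg|f bf f0]; rewrite /Phi /=.
- under eq_bigr do rewrite (mean_cst (kapply_mean _ _)) mulr1.
  by rewrite divff// gt_eqF.
- under eq_bigr => j _.
    rewrite (_ : kapply M s.+1 _ _ = a * kapply M s.+1 f (U s j w) + kapply M s.+1 g (U s j w)); last first.
      by have [_ lin _] := @kapply_mean _ _ _ M s.+1 (U s j w); exact: lin.
    rewrite mulrDr mulrCA; over.
  by rewrite big_split/= -mulr_sumr mulrDl mulrA.
- rewrite divr_ge0 ?(ltW S0)//; apply: sumr_ge0 => j _.
  by apply: mulr_ge0; [exact/ltW/Gp_gt0 | exact: (mean_ge0 (kapply_mean _ _))].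
Qed.

(* Generators of the information carried by the levels < s and the first n particles of
   level s. *)
Definition prodgen (s n : nat) (X : Om -> R) : Prop :=
  exists (h : nat -> nat -> E -> R) (f : nat -> E -> R),
  [/\ forall k j, bmeas (h k j), forall j, bmeas (f j) &
      X = fun w => (\prod_(k < s) \prod_(j < N k) h k j (U k j w)) *
                   \prod_(j < n) f j (U s j w)].

Notation adapted s n := (bclosure (prodgen s n)).

Lemma prodgen_bmeas s n X : prodgen s n X -> bmeas X.
Proof.
move=> [h [f [bh bf ->]]]; apply: bmeasM; last by apply: bmeas_prod => j; exact: U_bmeas.
by apply: bmeas_prod => k; apply: bmeas_prod => j; exact: U_bmeas.
Qed.

Lemma prodgen1 s n : prodgen s n (fun=> 1).
Proof.
exists (fun _ _ _ => 1), (fun _ _ => 1); split => [? ?|?|]; try exact: bmeas_cst.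
by apply/funext => w; rewrite !big1 ?mulr1// => i _; rewrite big1.
Qed.

Lemma prodgenM s n X Y : prodgen s n X -> prodgen s n Y -> prodgen s n (fun w => X w * Y w).
Proof.
move=> [h [f [bh bf ->]]] [h' [f' [bh' bf' ->]]].
exists (fun k j u => h k j u * h' k j u), (fun j u => f j u * f' j u).
split => [k j|j|]; try exact: bmeasM.
apply/funext => w; rewrite mulrACA -!big_split/=; congr (_ * _).
by apply: eq_bigr => k _; rewrite big_split.
Qed.

Lemma adapted_bmeas {s n X} : adapted s n X -> bmeas X.
Proof. exact: (bclosure_bmeas (prodgen_bmeas s n)). Qed.

Lemma adapted_past s n k j (f : E -> R) : (k < s)%N -> (j < N k)%N -> bmeas f ->
  adapted s n (fun w => f (U k j w)).
Proof.
move=> ks jN bf; apply: bclosure_base.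
exists (fun k' j' => if (k' == k) && (j' == j) then f else (fun=> 1)), (fun _ _ => 1).
split => [k' j'|?|]; [by case: ifP => _ //; exact: bmeas_cst | exact: bmeas_cst |].
apply/funext => w; rewrite [X in _ * X]big1// mulr1.
rewrite (bigD1 (Ordinal ks))//= (bigD1 (Ordinal jN))//= !eqxx/= !big1 ?mulr1//.
- move=> k' /negPf; rewrite -val_eqE/= => nk.
  by rewrite big1// => j' _; rewrite nk.
- by move=> j' /negPf; rewrite -val_eqE/= => nj; rewrite nj.
Qed.

Lemma adapted_present s n j (f : E -> R) : (j < n)%N -> bmeas f ->
  adapted s n (fun w => f (U s j w)).
Proof.
move=> jn bf; apply: bclosure_base.
exists (fun _ _ _ => 1), (fun j' => if j' == j then f else (fun=> 1)).
split => [? ?|j'|]; [exact: bmeas_cst | by case: ifP => _ //; exact: bmeas_cst |].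
apply/funext => w; rewrite [X in X * _]big1 ?mul1r; last by move=> k _; rewrite big1.
rewrite (bigD1 (Ordinal jn))//= eqxx big1 ?mulr1// => j' /negPf.
by rewrite -val_eqE/= => ->.
Qed.

Lemma adaptedM {s n X Y} : adapted s n X -> adapted s n Y -> adapted s n (fun w => X w * Y w).
Proof. exact: (bclosureM (prodgen_bmeas s n) (prodgenM s n)). Qed.

Lemma adapted_cst s n c : adapted s n (fun=> c).
Proof. exact: (bclosure_cst (prodgen1 s n)). Qed.

Lemma adaptedX {s n X} m : adapted s n X -> adapted s n (fun w => X w ^+ m).
Proof. exact: (bclosureX (prodgen1 s n) (prodgen_bmeas s n) (prodgenM s n)). Qed.

Lemma adaptedB {s n X Y} : adapted s n X -> adapted s n Y -> adapted s n (fun w => X w - Y w).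
Proof. exact: (bclosureB (prodgen1 s n)). Qed.

Lemma adapted_div {s n X Y} (c : R) : adapted s n X -> adapted s n Y ->
  (forall w, 0 < Y w) -> (forall w, `|X w| <= c * Y w) -> adapted s n (fun w => X w / Y w).
Proof. exact: (bclosure_div (prodgen1 s n) (prodgen_bmeas s n) (prodgenM s n)). Qed.

Lemma adapted_sum {s n} m (X : nat -> Om -> R) : (forall i, (i < m)%N -> adapted s n (X i)) ->
  adapted s n (fun w => \sum_(i < m) X i w).
Proof. by move=> H; apply: (bclosure_sum (prodgen1 s n)) => i; exact: H. Qed.

Lemma adapted_emp s n k (f : E -> R) : (k < s)%N -> bmeas f -> adapted s n (emp N U k f).
Proof.
move=> ks bf; apply: adaptedM; first exact: adapted_cst.
apply: (@adapted_sum s n (N k) (fun j w => f (U k j w))) => j jN.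
exact: adapted_past.
Qed.

(** The conditional law is a ratio of sums over the previous level, and its numerator is dominated
    by sup |f| times its denominator, as [adapted_div] requires. *)
Lemma adapted_smean s n (f : E -> R) : (s <= L)%N -> bmeas f -> adapted s n (smean s f).
Proof.
case: s => [_ _|s sL bf]; first exact: adapted_cst.
have [_ [b fb]] := bf.
apply: (@adapted_div _ _ (fun w => \sum_(j < N s) Gp gam s (U s j w) * kapply M s.+1 f (U s j w))
  (fun w => \sum_(j < N s) Gp gam s (U s j w)) b).
- apply: (@adapted_sum _ _ _ (fun j w => Gp gam s (U s j w) * kapply M s.+1 f (U s j w))) => j jN.
  by apply: adaptedM; apply: adapted_past => //; exact: kapply_bmeas.
- by apply: (@adapted_sum _ _ _ (fun j w => Gp gam s (U s j w))) => j jN; exact: adapted_past.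
- move=> w; move: (N s) (N_gt0 s sL) => [//|n'] _; rewrite big_ord_recl ltr_pwDl ?Gp_gt0//.
  by apply: sumr_ge0 => j _; rewrite ltW// Gp_gt0.
- move=> w; apply: le_trans (ler_norm_sum _ _ _) _; rewrite mulr_sumr.
  apply: ler_sum => j _; rewrite normrM mulrC (gtr0_norm (Gp_gt0 gam_pos _ _)).
  apply: ler_wpM2r; first exact/ltW/Gp_gt0.
  exact: (mean_norm (kapply_mean _ _)).
Qed.

Lemma smean_bmeas s {f : E -> R} : (s <= L)%N -> bmeas f -> bmeas (smean s f).
Proof. by move=> sL bf; exact: adapted_bmeas (adapted_smean s 0 f sL bf). Qed.

Lemma smean_norm s {f : E -> R} {b : R} w : (s <= L)%N -> bmeas f ->
  (forall u, `|f u| <= b) -> `|smean s f w| <= b.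
Proof. by move=> sL bf fb; exact: (mean_norm (smean_mean s w sL)). Qed.

(** Extends the two defining identities of [particle_system] from product test functions of the past
    to every adapted X, by treating the difference of the two sides as an orthogonality relation. *)
Lemma Ex_prod_smean s X (f : nat -> E -> R) : (s < L)%N -> adapted s 0 X ->
  (forall i, bmeas (f i)) ->
  Ex (fun w => X w * \prod_(i < N s) f i (U s i w)) =
  Ex (fun w => X w * \prod_(i < N s) smean s (f i) w).
Proof.
move=> sL aX bf; have bX := adapted_bmeas aX; apply/eqP; rewrite -subr_eq0; apply/eqP.
have bA : bmeas (fun w => \prod_(i < N s) f i (U s i w)).
  by apply: bmeas_prod => i; exact: U_bmeas.
have bB : bmeas (fun w => \prod_(i < N s) smean s (f i) w).
  by apply: bmeas_prod => i; apply: smean_bmeas => //; exact: ltnW.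
rewrite -(meanB Ex_mean); [|exact: bmeasM..].
under eq_fun do rewrite -mulrBr.
move: X aX {bX}; apply: (bclosure_orthogonal _ Ex_mean Ex_bcontinuous (prodgen_bmeas s 0)).
  exact: bmeasB.
move=> X [h [g [bh bg ->]]]; have [_ [PS0 PS1]] := PS.
have bh' : bmeas (fun w => \prod_(k < s) \prod_(j < N k) h k j (U k j w)).
  by apply: bmeas_prod => k; apply: bmeas_prod => j; exact: U_bmeas.
under eq_fun do rewrite big_ord0 mulr1 mulrBr.
rewrite (meanB Ex_mean); [|exact: bmeasM..].
apply/eqP; rewrite subr_eq0; apply/eqP/EFin_inj; rewrite !Ex_EFin; [|exact: bmeasM..].
case: s sL h bh bh' bA bB => [|s] sL h bh bh' bA bB.
  under eq_integral do rewrite big_ord0 mul1r; under [in RHS]eq_integral do rewrite big_ord0 mul1r.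
  rewrite PS0//=.
  by rewrite -Ex_EFin; [rewrite (mean_cst Ex_mean) | exact: bmeas_cst].
exact: PS1.
Qed.

Lemma prod_widen (F : nat -> R) n m : (n <= m)%N ->
  \prod_(i < m) (if (i < n)%N then F i else 1) = \prod_(i < n) F i.
Proof. by move=> nm; rewrite (big_ord_widen m F nm) [in RHS]big_mkcond. Qed.

(** The particles of one level, revealed one at a time, have martingale differences as centred
    values; this is conditional independence read off product functions. *)
Lemma Ex_orthogonal s n X (f : E -> R) : (s < L)%N -> (n < N s)%N -> adapted s n X ->
  bmeas f -> Ex (fun w => X w * (f (U s n w) - smean s f w)) = 0.
Proof.
move=> sL nN aX bf.
have bA : bmeas (fun w => f (U s n w) - smean s f w).
  by apply: bmeasB; [exact: U_bmeas | apply: smean_bmeas => //; exact: ltnW].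
move: X aX; apply: (bclosure_orthogonal _ Ex_mean Ex_bcontinuous (prodgen_bmeas s n) bA).
move=> X [h [g [bh bg ->]]].
pose Kp w := \prod_(k < s) \prod_(j < N k) h k j (U k j w).
have aK : adapted s 0 Kp.
  apply: bclosure_base; exists h, g; split => //.
  by apply/funext => w; rewrite big_ord0 mulr1.
(* Test functions padded with 1 beyond the particles in use. [f1] puts f at particle n; for [f2] the
   factor [smean s f] is moved into the past instead. After averaging, both give the same
   product. *)
pose f1 j := if (j < n.+1)%N then (if (j < n)%N then g j else f) else (fun=> 1).
pose f2 j := if (j < n)%N then g j else (fun=> 1).
have bf1 j : bmeas (f1 j) by rewrite /f1; case: ifP => _; [case: ifP | exact: bmeas_cst].
have bf2 j : bmeas (f2 j) by rewrite /f2; case: ifP => _ //; exact: bmeas_cst.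
have s1 w : smean s (fun=> 1) w = 1 by exact: (mean_cst (smean_mean s w (ltnW sL))).
have aKs : adapted s 0 (fun w => Kp w * smean s f w).
  by apply: adaptedM => //; apply: adapted_smean => //; exact: ltnW.
have E1 := Ex_prod_smean s Kp f1 sL aK bf1.
have E2 := Ex_prod_smean s _ f2 sL aKs bf2.
have X1 w : \prod_(i < N s) f1 i (U s i w) = \prod_(i < n) g i (U s i w) * f (U s n w).
  transitivity (\prod_(i < N s) (if (i < n.+1)%N then (if (i < n)%N then g i else f) (U s i w) else 1)).
    by apply: eq_bigr => i _; rewrite /f1; case: ifP.
  rewrite (prod_widen (fun i => (if (i < n)%N then g i else f) (U s i w)))// big_ord_recr/= ltnn.
  by congr (_ * _); apply: eq_bigr => i _; rewrite ltn_ord.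
have X2 w : \prod_(i < N s) smean s (f1 i) w = \prod_(i < n) smean s (g i) w * smean s f w.
  transitivity (\prod_(i < N s) (if (i < n.+1)%N then smean s (if (i < n)%N then g i else f) w else 1)).
    by apply: eq_bigr => i _; rewrite /f1; case: ifP => // _; rewrite s1.
  rewrite (prod_widen (fun i => smean s (if (i < n)%N then g i else f) w))// big_ord_recr/= ltnn.
  by congr (_ * _); apply: eq_bigr => i _; rewrite ltn_ord.
have X3 w : \prod_(i < N s) f2 i (U s i w) = \prod_(i < n) g i (U s i w).
  transitivity (\prod_(i < N s) (if (i < n)%N then g i (U s i w) else 1)).
    by apply: eq_bigr => i _; rewrite /f2; case: ifP.
  by rewrite (prod_widen (fun i => g i (U s i w)))// ltnW.
have X4 w : \prod_(i < N s) smean s (f2 i) w = \prod_(i < n) smean s (g i) w.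
  transitivity (\prod_(i < N s) (if (i < n)%N then smean s (g i) w else 1)).
    by apply: eq_bigr => i _; rewrite /f2; case: ifP => // _; rewrite s1.
  by rewrite (prod_widen (fun i => smean s (g i) w))// ltnW.
have bP : bmeas (fun w => \prod_(i < n) g i (U s i w)).
  by apply: bmeas_prod => i; exact: U_bmeas.
have bK := adapted_bmeas aK; have bKs := adapted_bmeas aKs.
rewrite (_ : (fun w => _) = fun w => Kp w * \prod_(i < N s) f1 i (U s i w) -
    Kp w * smean s f w * \prod_(i < N s) f2 i (U s i w)); last first.
  by apply/funext => w; rewrite X1 X3 /Kp; ring.
rewrite (meanB Ex_mean).
- rewrite E1 E2; apply/eqP; rewrite subr_eq0; apply/eqP; congr Ex.
  by apply/funext => w; rewrite X2 X4; ring.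
- by apply: bmeasM => //; apply: bmeas_prod => i; exact: U_bmeas.
- by apply: bmeasM => //; apply: bmeas_prod => i; exact: U_bmeas.
Qed.

(** * Moments of the sampling errors *)

Definition increment s (f : E -> R) n w := f (U s n w) - smean s f w.

Definition partial_sum s f n w := \sum_(i < n) increment s f i w.

Lemma increment_norm s f (b : R) n w : (s <= L)%N -> bmeas f -> (forall u, `|f u| <= b) ->
  `|increment s f n w| <= 2 * b.
Proof.
move=> sL bf fb; apply: le_trans (ler_normB _ _) _; rewrite mulrDl mul1r lerD//.
exact: smean_norm.
Qed.

Lemma increment_bmeas s f n : (s <= L)%N -> bmeas f -> bmeas (increment s f n).
Proof. by move=> sL bf; apply: bmeasB; [exact: U_bmeas | exact: smean_bmeas]. Qed.

Lemma partial_sum_adapted s f n : (s <= L)%N -> bmeas f -> adapted s n (partial_sum s f n).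
Proof.
move=> sL bf; apply: (@adapted_sum s n n (increment s f)) => i iN.
by apply: adaptedB; [exact: adapted_present | exact: adapted_smean].
Qed.

Lemma partial_sumS s f n w : partial_sum s f n.+1 w = partial_sum s f n w + increment s f n w.
Proof. by rewrite /partial_sum big_ord_recr. Qed.

(** The cross term of each new square vanishes by orthogonality, so the squared increments, each at
    most (2 b)^2, simply add up. *)
Lemma partial_sum_L2 s f (b : R) n : (s < L)%N -> (n <= N s)%N -> bmeas f ->
  (forall u, `|f u| <= b) -> Ex (fun w => partial_sum s f n w ^+ 2) <= n%:R * (2 * b) ^+ 2.
Proof.
move=> sL + bf fb; have sL' := ltnW sL; elim: n => [_|n IH nN].
  rewrite mul0r (_ : (fun w => _) = fun=> 0) ?(mean0 Ex_mean)//.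
  by apply/funext => w; rewrite /partial_sum big_ord0 expr0n.
set S := partial_sum s f n; set X := increment s f n.
have aS := partial_sum_adapted s f n sL' bf; have bS := adapted_bmeas aS.
have bX := increment_bmeas s f n sL' bf.
rewrite (_ : (fun w => _) = fun w => S w ^+ 2 + (2 * (S w * X w) + X w ^+ 2)); last first.
  by apply/funext => w; rewrite partial_sumS -/S -/X; ring.
have b1 := bmeasX 2 bS; have b2 := bmeasZ 2 (bmeasM bS bX); have b3 := bmeasX 2 bX.
rewrite (meanD Ex_mean) ?(meanD Ex_mean)//; last exact: bmeasD.
rewrite (meanZ Ex_mean); last exact: bmeasM.
rewrite Ex_orthogonal// mulr0 add0r -natr1 mulrDl mul1r; apply: lerD; first exact/IH/ltnW.
rewrite -[leRHS](mean_cst Ex_mean); apply: (mean_le Ex_mean) => //; first exact: bmeas_cst.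
move=> w; have := increment_norm s f b n w sL' bf fb; rewrite -/X => h.
by rewrite -(real_normK (num_real (X w))) lerXn2r// nnegrE// (le_trans _ h).
Qed.

(** With c = 2 b, one step adds at most 8 c^2 E[S^2] + 3 c^4 <= (8 n + 3) c^4, which is below 4 ((n
    + 1)^2 - n^2) c^4; this is the origin of the factor 4. *)
Lemma partial_sum_L4 s f (b : R) n : 0 <= b -> (s < L)%N -> (n <= N s)%N -> bmeas f ->
  (forall u, `|f u| <= b) ->
  Ex (fun w => partial_sum s f n w ^+ 4) <= 4 * n%:R ^+ 2 * (2 * b) ^+ 4.
Proof.
move=> b0 sL + bf fb; have sL' := ltnW sL; elim: n => [_|n IH nN].
  rewrite expr0n mulr0 mul0r (_ : (fun w => _) = fun=> 0) ?(mean0 Ex_mean)//.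
  by apply/funext => w; rewrite /partial_sum big_ord0 expr0n.
have S2 := partial_sum_L2 s f b n sL (ltnW nN) bf fb.
have aS := partial_sum_adapted s f n sL' bf.
have O3 := Ex_orthogonal s n _ f sL nN (adaptedX 3 aS) bf.
have {IH} := IH (ltnW nN); move: S2 O3.
under eq_fun do rewrite -/(increment s f n _).
under [X in _ -> Ex X = 0 -> _]eq_fun do rewrite -/(increment s f n _).
set S := partial_sum s f n in aS *; set X := increment s f n.
have bS := adapted_bmeas aS.
have bX : bmeas X := increment_bmeas s f n sL' bf.
set c := 2 * b => S2 O3 S4.
have c0 : 0 <= c by rewrite mulr_ge0.
have Xc w : X w ^+ 2 <= c ^+ 2.
  have h := increment_norm s f b n w sL' bf fb.
  by rewrite -(real_normK (num_real (X w))) lerXn2r// nnegrE.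
(* The cubic term of (S + X)^4 is kept exactly because its mean is zero; in the rest 4 S X^3 <= 2
   X^2 (S^2 + X^2) and X^2 <= c^2. *)
have H : Ex (fun w => partial_sum s f n.+1 w ^+ 4) <=
    Ex (fun w => S w ^+ 4 + (4 * (S w ^+ 3 * X w) + (8 * c ^+ 2 * S w ^+ 2 + 3 * c ^+ 4))).
  apply: (mean_le Ex_mean).
  - by apply: bmeasX; exact: adapted_bmeas (partial_sum_adapted s f n.+1 sL' bf).
  - apply: bmeasD; first exact: bmeasX.
    apply: bmeasD; first by apply: bmeasZ; apply: bmeasM => //; exact: bmeasX.
    by apply: bmeasD; [apply: bmeasZ; exact: bmeasX | exact: bmeas_cst].
  - move=> w; rewrite partial_sumS -/S -/X; have := Xc w.
    move: (S w) (X w) => y x; rewrite (_ : c ^+ 4 = (c ^+ 2) ^+ 2); last by rewrite -exprM.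
    move: (c ^+ 2) => k xk.
    have h1 : 0 <= y ^+ 2 * (k - x ^+ 2) by rewrite mulr_ge0 ?sqr_ge0// subr_ge0.
    have h2 : x ^+ 2 * x ^+ 2 <= k * k by rewrite ler_pM// sqr_ge0.
    have h3 : 0 <= x ^+ 2 * (y - x) ^+ 2 by rewrite mulr_ge0 ?sqr_ge0.
    rewrite -subr_ge0.
    have -> : y ^+ 4 + (4 * (y ^+ 3 * x) + (8 * k * y ^+ 2 + 3 * k ^+ 2)) - (y + x) ^+ 4 =
      8 * (y ^+ 2 * (k - x ^+ 2)) + 3 * (k * k - x ^+ 2 * x ^+ 2) + 2 * (x ^+ 2 * (y - x) ^+ 2) by ring.
    by rewrite !addr_ge0// mulr_ge0// subr_ge0.
apply: (le_trans H) => {H}.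
have bS2 := bmeasX 2 bS; have bS3 := bmeasX 3 bS; have bS4 := bmeasX 4 bS.
have b1 := bmeasZ (8 * c ^+ 2) bS2; have b2 := bmeas_cst (T := Om) (3 * c ^+ 4).
have b3 := bmeasZ 4 (bmeasM bS3 bX).
rewrite (meanD Ex_mean bS4 (bmeasD b3 (bmeasD b1 b2))) (meanD Ex_mean b3 (bmeasD b1 b2)).
rewrite (meanD Ex_mean b1 b2) (meanZ Ex_mean _ bS2) (mean_cst Ex_mean) (meanZ Ex_mean _ (bmeasM bS3 bX)).
rewrite O3 mulr0 add0r -[n.+1%:R]natr1.
have c2 := sqr_ge0 c.
have h := ler_wpM2l (mulr_ge0 (ler0n _ 8) c2) S2.
apply: (@le_trans _ _ (4 * n%:R ^+ 2 * c ^+ 4 + (8 * c ^+ 2 * (n%:R * c ^+ 2) + 3 * c ^+ 4))).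
  by apply: lerD => //; exact: lerD.
rewrite (_ : c ^+ 4 = (c ^+ 2) ^+ 2); last by rewrite -exprM.
move: (c ^+ 2) (n%:R) => k y; rewrite -subr_ge0.
have -> : 4 * (y + 1) ^+ 2 * k ^+ 2 - (4 * y ^+ 2 * k ^+ 2 + (8 * k * (y * k) + 3 * k ^+ 2)) = k ^+ 2 by ring.
exact: sqr_ge0.
Qed.

Lemma emp_smean s f w : (s < L)%N ->
  emp N U s f w - smean s f w = (N s)%:R^-1 * partial_sum s f (N s) w.
Proof.
move=> sL; have N0 : (N s)%:R != 0 :> R by rewrite pnatr_eq0 -lt0n N_gt0.
rewrite /partial_sum sumrB sumr_const card_ord mulrBr /emp; congr (_ - _).
by rewrite -[X in _ = _ * X]mulr_natl mulKf.
Qed.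

Lemma sampling_error_L4 s f (b : R) : 0 <= b -> (s < L)%N -> bmeas f ->
  (forall u, `|f u| <= b) ->
  L4bound Ex (fun w => emp N U s f w - smean s f w) (3 * b / Num.sqrt (N s)%:R).
Proof.
move=> b0 sL bf fb; have sL' := ltnW sL.
have N0 : 0 < (N s)%:R :> R by rewrite ltr0n N_gt0.
have bS := adapted_bmeas (partial_sum_adapted s f (N s) sL' bf).
under eq_fun do rewrite emp_smean//.
split; [exact: bmeasZ | by rewrite divr_ge0 ?mulr_ge0 ?sqrtr_ge0 |].
under eq_fun do rewrite exprMn.
rewrite (meanZ Ex_mean); last exact: bmeasX.
have := partial_sum_L4 s f b (N s) b0 sL (leqnn _) bf fb => h.
rewrite expr_div_n (_ : Num.sqrt _ ^+ 4 = (N s)%:R ^+ 2); last first.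
  by rewrite (exprM _ 2 2) sqr_sqrtr// ltW.
have -> : ((N s)%:R^-1) ^+ 4 = ((N s)%:R ^+ 2)^-1 * ((N s)%:R ^+ 2)^-1 :> R.
  by rewrite -invfM -exprD exprVn.
rewrite -mulrA [leRHS]mulrC; apply: ler_wpM2l; first by rewrite invr_ge0 exprn_ge0// ltW.
rewrite mulrC ler_pdivrMr ?exprn_gt0//; apply: (le_trans h).
(* The constant 3 of the statement comes from 4 * 2^4 = 64 <= 81 = 3^4. *)
have -> : 4 * (N s)%:R ^+ 2 * (2 * b) ^+ 4 = (64 * b ^+ 4) * (N s)%:R ^+ 2 by ring.
apply: ler_wpM2r; first by rewrite exprn_ge0// ltW.
have b4 : 0 <= b ^+ 4 by exact: exprn_ge0.
have -> : (3 * b) ^+ 4 = 81 * b ^+ 4 by ring.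
by apply: ler_wpM2r => //; lra.
Qed.

Lemma adapted_widen s n X : adapted s 0 X -> adapted s n X.
Proof.
elim=> [Y [h [f [bh bf ->]]]|a Y Z _ aY _ aZ|F Y c _ aF Fc FY].
- apply: bclosure_base; exists h, (fun _ _ => 1); split => // [?|]; first exact: bmeas_cst.
  by apply/funext => w; congr (_ * _); rewrite big_ord0 big1.
- exact: bclosure_lin.
- exact: (bclosure_lim _ F Y c aF Fc FY).
Qed.

Lemma Ex_emp_orthogonal s X (f : E -> R) : (s < L)%N -> adapted s 0 X -> bmeas f ->
  Ex (fun w => X w * (emp N U s f w - smean s f w)) = 0.
Proof.
move=> sL aX bf; have bX := adapted_bmeas aX.
rewrite (_ : (fun w => _) =
  fun w => (N s)%:R^-1 * \sum_(i < N s) X w * increment s f i w); last first.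
  by apply/funext => w; rewrite emp_smean// /partial_sum mulrCA mulr_sumr.
have bI i : bmeas (fun w => X w * increment s f i w).
  by apply: (bmeasM bX); exact: (increment_bmeas s f i (ltnW sL) bf).
rewrite (meanZ Ex_mean); last exact: bmeas_sum.
rewrite (mean_sum Ex_mean (N s) (fun i w => X w * increment s f i w))//.
rewrite big1 ?mulr0// => i _; apply: Ex_orthogonal => //; exact: adapted_widen.
Qed.

Lemma emp_mean s w : (s < L)%N -> mean (fun f : E -> R => emp N U s f w).
Proof.
move=> sL; have N0 : 0 < (N s)%:R :> R by rewrite ltr0n N_gt0.
split => [|a f g bf bg|f bf f0]; rewrite /emp.
- by rewrite sumr_const card_ord -[X in _ * X]mulr_natl mulr1 mulVf// gt_eqF.
- by rewrite big_split/= -mulr_sumr mulrDr mulrCA.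
- by rewrite mulr_ge0 ?invr_ge0 ?(ltW N0)//; apply: sumr_ge0.
Qed.

Lemma emp_bmeas s (f : E -> R) : bmeas f -> bmeas (emp N U s f).
Proof. by move=> bf; apply: bmeasZ; apply: bmeas_sum => j; exact: U_bmeas. Qed.

(** * Error terms along the Feynman-Kac flow and their L^4 size *)

Context {Cl Cu : R} (Cl0 : 0 < Cl) (ClCu : Cl < Cu).
Context (A1 : forall l u, (1 <= l)%N -> Cl <= Gp gam l u <= Cu).
Context {rho : R} (Hrho : 0 < rho < 1).
Context (A2 : forall l, (1 <= l)%N -> forall u v A, measurable A ->
     (rho%:E * M l v A <= M l u A)%E).
Context (M_inv : forall l, (1 <= l)%N -> forall A, measurable A ->
     (\int[mu]_u (M l u A * (gam l u / Zc mu gam l)%:E) =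
      \int[mu]_(u in A) (gam l u / Zc mu gam l)%:E)%E).
Context (N_mono : forall l, (l.+1 < L)%N -> (N l.+1 <= N l)%N).
Context (y0 : E).

Notation FKf := (@FK R d E M gam).
Notation q k s := (FKf k s (fun=> 1)).
Notation kp := (kappa rho).
Notation B := (Bq Cl Cu rho).
Notation eta := (eta_ mu gam).

Let eta_mn l : mean (eta l). Proof. exact: eta_mean. Qed.
Let kp0 : 0 < kp. Proof. exact: kappa_gt0. Qed.
Let kp1 : kp < 1. Proof. exact: kappa_lt1. Qed.
Let B1 : 1 <= B. Proof. exact: Bq_ge1. Qed.
Let B0 : 0 < B. Proof. exact: lt_le_trans B1. Qed.
Let K0 : 0 <= K. Proof. exact: le_trans (ltW (Gn_gt0 0 y0)) (Gn_le 0 y0). Qed.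

Lemma eta_Gn l f : bmeas f -> eta l (fun u => f u * Gn l u) = eta l.+1 f.
Proof.
move=> bf; have := eta_Gp gam_pos Z_fin Z_pos l f.
under eq_fun do rewrite GpE mulrCA.
rewrite (meanZ (eta_mn l)); last by apply: bmeasM => //; exact: Gn_bmeas.
by apply: mulfI; rewrite gt_eqF// divr_gt0.
Qed.

Lemma mean_ratioP (I : (E -> R) -> R) (phi psi : E -> R) (dl : R) : mean I ->
  bmeas phi -> bmeas psi -> (forall u, B^-1 <= psi u <= B) ->
  (forall u, 0 <= phi u <= dl * psi u) -> [/\ B^-1 <= I psi, 0 <= I phi & I phi <= dl * I psi].
Proof.
move=> mI bphi bpsi Hpsi Hphi; split.
- rewrite -(mean_cst mI B^-1); apply: (mean_le mI) => // [|u]; first exact: bmeas_cst.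
  by case/andP: (Hpsi u).
- by apply: (mean_ge0 mI) => // u; case/andP: (Hphi u).
- rewrite -(meanZ mI)//; apply: (mean_le mI) => // [|u]; first exact: bmeasZ.
  by case/andP: (Hphi u).
Qed.

(** The error of the denominator is multiplied by the ratio a' / b' <= dl, so the small factor dl is
    not lost when denominators are compared. *)
Lemma ratio_diff (a b a' b' dl : R) : B^-1 <= b -> B^-1 <= b' -> 0 <= a' -> a' <= dl * b' ->
  `|a / b - a' / b'| <= B * (`|a - a'| + dl * `|b - b'|).
Proof.
have Bi : 0 < B^-1 by rewrite invr_gt0.
move=> /[dup] Bb /(lt_le_trans Bi) b0 /(lt_le_trans Bi) b'0 a'0 a'b'.
have -> : a / b - a' / b' = b^-1 * ((a - a') - a' / b' * (b - b')).
  by field; rewrite !gt_eqF.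
rewrite normrM; apply: ler_pM => //.
  by rewrite gtr0_norm ?invr_gt0// -[leRHS]invrK lef_pV2// posrE.
apply: le_trans (ler_normB _ _) _; rewrite lerD2l normrM ler_wpM2r//.
by rewrite ger0_norm ?divr_ge0 ?(ltW b'0)// ler_pdivrMr.
Qed.

(* [Wr r f s] and [Vr r f s] are the time-[r] Feynman-Kac predictions of [f] started from
   the empirical measure of level [s], resp. from the conditional law of its particles. *)
Definition Wr r (f : E -> R) s w := emp N U s (FKf (r - s) s f) w / emp N U s (q (r - s) s) w.
Definition Vr r (f : E -> R) s w := smean s (FKf (r - s) s f) w / smean s (q (r - s) s) w.

(* The contribution of the sampling at level [s] to the error [emp r f - eta r f]. *)
Definition Tr r (f : E -> R) s w := Wr r f s w - (if s is s'.+1 then Wr r f s' w else eta r f).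

(** Reweighting the empirical measure and moving it by the kernel gives the conditional law of the
    next level up to a scalar, which cancels in the ratio. Hence [Tr] at a positive level compares
    an empirical measure with its own conditional law. *)
Lemma Wr_Vr r f s w : (s < r)%N -> (s < L)%N -> Wr r f s w = Vr r f s.+1 w.
Proof.
move=> sr sL; rewrite /Wr /Vr -subnSK//= /emp /Phi /=.
have N0 : (N s)%:R != 0 :> R by rewrite pnatr_eq0 -lt0n N_gt0.
set S := \sum_(j < N s) Gp gam s _.
have S0 : S != 0.
  rewrite gt_eqF// /S; move: (N s) (N_gt0 s sL) => [//|n] _.
  by rewrite big_ord_recl ltr_pwDl ?Gp_gt0//; apply: sumr_ge0 => j _; exact/ltW/Gp_gt0.
have frac (n a b t : R) : n != 0 -> t != 0 -> (n * a) / (n * b) = (a / t) / (b / t).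
  by move=> n0 t0; rewrite -mulf_div divff// mul1r -[RHS]mulf_div divff ?mulr1 ?invr_neq0.
by apply: frac; rewrite ?invr_neq0.
Qed.

Lemma sum_Tr r f w : (r < L)%N -> emp N U r f w - eta r f = \sum_(0 <= s < r.+1) Tr r f s w.
Proof.
move=> rL; have -> : emp N U r f w = Wr r f r w.
  by rewrite /Wr subnn/= (mean_cst (emp_mean r w rL)) divr1.
have H n : \sum_(0 <= s < n.+1) Tr r f s w = Wr r f n w - eta r f.
  elim: n => [|n IH]; first by rewrite big_nat1.
  by rewrite big_nat_recr//= IH /Tr addrC addrA subrK.
by rewrite H.
Qed.

(** The constant is Z_(s+k) / Z_s; only its independence of f is recorded, since it cancels in
    [eta_FK_ratio]. *)
Lemma eta_FK k s : (1 <= s)%N -> exists2 c : R, c != 0 &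
  forall f, bmeas f -> eta s (FKf k s f) = c * eta (s + k) f.
Proof.
elim: k s => [|k IH] s s1.
  by exists 1 => // f bf; rewrite addn0 mul1r.
have [c c0 H] := IH s.+1 isT.
exists (Zc mu gam s.+1 / Zc mu gam s * c).
  by apply: mulf_neq0 => //; rewrite gt_eqF// divr_gt0.
move=> f bf /=; under eq_fun do rewrite mulrC.
rewrite (eta_Gp gam_pos Z_fin Z_pos) (eta_kapply gam_meas gam_pos Z_fin Z_pos M_inv)//.
  by rewrite H// mulrA addnS addSn.
exact: (FK_bmeas gam_meas gam_pos A1).
Qed.

Lemma eta_FK_ratio r s f : (1 <= s <= r)%N -> bmeas f ->
  eta r f = eta s (FKf (r - s) s f) / eta s (q (r - s) s).
Proof.
move=> /andP[s1 sr] bf; have [c c0 H] := eta_FK (r - s) s s1.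
rewrite !H//; last exact: bmeas_cst.
by rewrite subnKC// (mean_cst (eta_mn r)) mulr1 mulrC mulKf.
Qed.

Lemma FK_ratio_normalize k s f (b : R) : (1 <= s)%N -> bmeas f -> (forall u, `|f u| <= b) ->
  exists m phi psi, [/\ bmeas phi, bmeas psi,
    (forall u, B^-1 <= psi u <= B),
    (forall u, 0 <= phi u <= 2 * b * kp ^+ k * psi u) &
    forall I, mean I -> I (FKf k s f) / I (q k s) = m + I phi / I psi].
Proof. exact: (FK_normalize gam_meas gam_pos Cl0 ClCu A1 Hrho A2 y0). Qed.

(** 12 B^2 is the cost of sampling at a positive level. Level 0 adds 2 K + 1 for its reweighting,
    and 1 / kappa because contraction begins only at level 1. *)
Definition C1 := 12 * (2 * K + 1) * B ^+ 2 / kp.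
Definition C2 := 36 * B ^+ 4.

Let K21 : 1 <= 2 * K + 1. Proof. by rewrite lerDr mulr_ge0. Qed.

Let sN s : 0 <= Num.sqrt (N s)%:R :> R. Proof. exact: sqrtr_ge0. Qed.

Let B2 : 1 <= B ^+ 2. Proof. by rewrite exprn_ege1. Qed.

Let C1_large : 12 * B ^+ 2 <= C1.
Proof.
rewrite /C1 ler_pdivlMr//; apply: (@le_trans _ _ (12 * B ^+ 2)).
  by rewrite ger_pMr ?(ltW kp1)// mulr_gt0// exprn_gt0.
by rewrite mulrAC ler_peMr// mulr_ge0// exprn_ge0// ltW.
Qed.

Let C1_ge0 : 0 <= C1.
Proof. by apply: le_trans C1_large; rewrite mulr_ge0// exprn_ge0// ltW. Qed.

Lemma ratio_bmeas {X Y : Om -> R} {dl : R} : bmeas X -> bmeas Y -> (forall w, B^-1 <= Y w) ->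
  (forall w, 0 <= X w) -> (forall w, X w <= dl * Y w) -> bmeas (fun w => X w / Y w).
Proof.
move=> bX bY HY X0 HX; apply: (bmeas_div (c := dl)) => // w.
  by apply: (lt_le_trans _ (HY w)); rewrite invr_gt0.
by rewrite ger0_norm.
Qed.

Lemma L4bound_norm {X : Om -> R} {x} : L4bound Ex X x -> L4bound Ex (fun w => `|X w|) x.
Proof.
move=> hX; apply: (L4bound_dom Ex_mean _ _ hX) => [|w].
  by apply: bmeas_norm; exact: L4bound_bmeas hX.
by rewrite normr_id.
Qed.

Lemma ratio_diff_L4 (X Y X' Y' : Om -> R) (dl x y : R) : 0 <= dl ->
  bmeas X -> bmeas Y -> bmeas X' -> bmeas Y' ->
  (forall w, B^-1 <= Y w) -> (forall w, 0 <= X w) -> (forall w, X w <= dl * Y w) ->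
  (forall w, B^-1 <= Y' w) -> (forall w, 0 <= X' w) -> (forall w, X' w <= dl * Y' w) ->
  L4bound Ex (fun w => X w - X' w) x -> L4bound Ex (fun w => Y w - Y' w) y ->
  L4bound Ex (fun w => X w / Y w - X' w / Y' w) (B * (x + dl * y)).
Proof.
move=> dl0 bX bY bX' bY' HY X0 XY HY' X'0 XY' hx hy.
have H := L4boundZ Ex_mean B (L4boundD Ex_mean (L4bound_norm hx) (L4boundZ Ex_mean dl (L4bound_norm hy))).
rewrite (ger0_norm dl0) (gtr0_norm B0) in H.
apply: (L4bound_dom Ex_mean _ _ H) => [|w].
  by apply: bmeasB; [exact: ratio_bmeas XY | exact: ratio_bmeas XY'].
rewrite [leRHS]ger0_norm; first exact: ratio_diff.
by rewrite mulr_ge0 ?(ltW B0)// addr_ge0// mulr_ge0.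
Qed.

Lemma FK_normalized_norm {phi psi : E -> R} {dl : R} : 0 <= dl -> (forall u, B^-1 <= psi u <= B) ->
  (forall u, 0 <= phi u <= dl * psi u) ->
  (forall u, `|psi u| <= B) /\ (forall u, `|phi u| <= dl * B).
Proof.
move=> dl0 Hpsi Hphi; split => u; have /andP[h1 h2] := Hpsi u.
  by rewrite ger0_norm// (le_trans _ h1)// invr_ge0 ltW.
have /andP[h3 h4] := Hphi u; rewrite ger0_norm//; apply: (le_trans h4).
by rewrite ler_wpM2l.
Qed.

Lemma Tr_succ r f s w : (s < r < L)%N -> Tr r f s.+1 w = Wr r f s.+1 w - Vr r f s.+1 w.
Proof. by move=> /andP[sr rL]; rewrite /Tr (Wr_Vr r f s)//; exact: ltn_trans rL. Qed.

(** After [FK_ratio_normalize] the shift m cancels; numerator and denominator then carry sampling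
    errors of sizes 3 dl B and 3 B over the root of the particle number. *)
Lemma Tr_succ_L4 r s f (b : R) : (s < r < L)%N -> bmeas f -> 0 <= b -> (forall u, `|f u| <= b) ->
  L4bound Ex (Tr r f s.+1) (C1 * b * kp ^+ (r - s.+1) / Num.sqrt (N s.+1)%:R).
Proof.
move=> /[dup] srL /andP[sr rL] bf b0 fb; have sL : (s.+1 < L)%N by exact: leq_ltn_trans sr rL.
have [m [phi [psi [bphi bpsi Hpsi Hphi H]]]] := FK_ratio_normalize (r - s.+1) s.+1 f b isT bf fb.
set dl := 2 * b * kp ^+ (r - s.+1) in Hphi.
have dl0 : 0 <= dl by rewrite !mulr_ge0// exprn_ge0// ltW.
have [npsi nphi] := FK_normalized_norm dl0 Hpsi Hphi.
have -> : Tr r f s.+1 = fun w => emp N U s.+1 phi w / emp N U s.+1 psi w -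
    smean s.+1 phi w / smean s.+1 psi w.
  apply/funext => w; rewrite Tr_succ// /Wr /Vr.
  have := H _ (emp_mean s.+1 w sL) => ->.
  have := H _ (smean_mean s.+1 w (ltnW sL)) => ->.
  by rewrite opprD addrACA subrr add0r.
have He w := mean_ratioP _ _ _ _ (emp_mean s.+1 w sL) bphi bpsi Hpsi Hphi.
have Hs w := mean_ratioP _ _ _ _ (smean_mean s.+1 w (ltnW sL)) bphi bpsi Hpsi Hphi.
have e1 := sampling_error_L4 s.+1 phi (dl * B) (mulr_ge0 dl0 (ltW B0)) sL bphi nphi.
have e2 := sampling_error_L4 s.+1 psi B (ltW B0) sL bpsi npsi.
have := ratio_diff_L4 _ _ _ _ dl _ _ dl0 (emp_bmeas _ _ bphi) (emp_bmeas _ _ bpsi)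
  (smean_bmeas _ (ltnW sL) bphi) (smean_bmeas _ (ltnW sL) bpsi)
  (fun w => let: And3 h _ _ := He w in h) (fun w => let: And3 _ h _ := He w in h)
  (fun w => let: And3 _ _ h := He w in h)
  (fun w => let: And3 h _ _ := Hs w in h) (fun w => let: And3 _ h _ := Hs w in h)
  (fun w => let: And3 _ _ h := Hs w in h) e1 e2.
apply: L4bound_le.
have -> : B * (3 * (dl * B) / Num.sqrt (N s.+1)%:R + dl * (3 * B / Num.sqrt (N s.+1)%:R)) =
  12 * B ^+ 2 * (b * kp ^+ (r - s.+1) / Num.sqrt (N s.+1)%:R) by rewrite /dl; ring.
have -> : C1 * b * kp ^+ (r - s.+1) / Num.sqrt (N s.+1)%:R =
  C1 * (b * kp ^+ (r - s.+1) / Num.sqrt (N s.+1)%:R) by rewrite !mulrA.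
by apply: ler_wpM2r => //; rewrite !mulr_ge0 ?invr_ge0// exprn_ge0// ltW.
Qed.

(* [upd p g] is the ratio A_p of the header. *)
Definition upd p (f : E -> R) w :=
  emp N U p (fun u => f u * Gp gam p u) w / emp N U p (Gp gam p) w.

Lemma emp_Gp_gt0 p w : (p < L)%N -> 0 < emp N U p (Gp gam p) w.
Proof.
move=> pL; rewrite /emp; apply: mulr_gt0; first by rewrite invr_gt0 ltr0n N_gt0.
move: (N p) (N_gt0 p pL) => [//|n] _; rewrite big_ord_recl ltr_pwDl ?Gp_gt0//.
by apply: sumr_ge0 => j _; exact/ltW/Gp_gt0.
Qed.

Lemma upd_le p f (b : R) w : (p < L)%N -> bmeas f -> (forall u, `|f u| <= b) ->
  `|emp N U p (fun u => f u * Gp gam p u) w| <= b * emp N U p (Gp gam p) w.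
Proof.
move=> pL bf fb; have em := emp_mean p w pL; rewrite -(meanZ em)//.
have bfG : bmeas (fun u => f u * Gp gam p u) by exact: bmeasM.
have bbG : bmeas (fun u => b * Gp gam p u) by exact: bmeasZ.
have H u : `|f u * Gp gam p u| <= b * Gp gam p u.
  by rewrite normrM (gtr0_norm (Gp_gt0 gam_pos _ _)) ler_wpM2r//; exact/ltW/Gp_gt0.
rewrite ler_norml; apply/andP; split; last first.
  by apply: (mean_le em) => // u; apply: le_trans (H u); exact: ler_norm.
rewrite -mulN1r -(meanZ em)//; apply: (mean_le em) => // [|u]; first exact: bmeasZ.
by have := H u; rewrite ler_norml mulN1r => /andP[].
Qed.

Lemma upd_norm p f (b : R) w : (p < L)%N -> bmeas f -> (forall u, `|f u| <= b) -> `|upd p f w| <= b.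
Proof.
move=> pL bf fb; have G0 := emp_Gp_gt0 p w pL.
by rewrite normrM normfV (gtr0_norm G0) ler_pdivrMr// upd_le.
Qed.

Lemma upd_adapted s n p f : (p < s)%N -> (p < L)%N -> bmeas f -> adapted s n (upd p f).
Proof.
move=> ps pL bf; have [_ [b fb]] := bf.
apply: (adapted_div b) => [||w|w].
- by apply: adapted_emp => //; exact: bmeasM.
- exact: adapted_emp.
- exact: emp_Gp_gt0.
- exact: upd_le.
Qed.

Lemma upd_smean p f w : (p < L)%N -> upd p (kapply M p.+1 f) w = smean p.+1 f w.
Proof.
move=> pL; rewrite /upd /emp /= /Phi/=.
have N0 : (N p)%:R != 0 :> R by rewrite pnatr_eq0 -lt0n N_gt0.
rewrite -mulf_div divff ?invr_neq0// mul1r; congr (_ / _).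
by apply: eq_bigr => j _; rewrite mulrC.
Qed.

(** Rests on A_p e(G) = e(f G) for the empirical mean e, and on the normalised weight having
    eta_p-mean 1. The denominator error has the bounded coefficient [upd p f], so no inverse of a
    weight appears. *)
Lemma upd_err p f w : (p < L)%N -> bmeas f -> upd p f w - eta p.+1 f =
  (emp N U p (fun u => f u * Gn p u) w - eta p (fun u => f u * Gn p u)) -
  upd p f w * (emp N U p (fun u => Gn p u - 1) w - eta p (fun u => Gn p u - 1)).
Proof.
move=> pL bf; have em := emp_mean p w pL.
have bG := Gn_bmeas p; have b1 : bmeas (fun _ : E => 1 : R) by exact: bmeas_cst.
rewrite eta_Gn// (meanB em)// (meanB (eta_mn p))// (mean_cst em) (mean_cst (eta_mn p)).
have -> : eta p (Gn p) = 1.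
  have := eta_Gn p (fun=> 1) b1; under eq_fun do rewrite mul1r.
  by move=> ->; rewrite (mean_cst (eta_mn p.+1)).
rewrite subrr subr0.
have -> : emp N U p (fun u => f u * Gn p u) w = upd p f w * emp N U p (Gn p) w.
  have G0 := emp_Gp_gt0 p w pL.
  have c0 : Zc mu gam p / Zc mu gam p.+1 != 0 by rewrite gt_eqF// divr_gt0.
  rewrite /upd {2}/Gn (meanZ em)//.
  rewrite (_ : (fun u => f u * Gn p u) = fun u => Zc mu gam p / Zc mu gam p.+1 * (f u * Gp gam p u)); last first.
    by apply/funext => u; rewrite /Gn mulrCA.
  by rewrite (meanZ em); [field; rewrite !gt_eqF | exact: bmeasM].
by ring.
Qed.

(** The rate c is abstract since this serves twice: with the plain sampling error at level 0, and
    with the full empirical error at level r. The constant is K for the numerator plus K + 1 for the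
    centred denominator. *)
Lemma upd_L4 p f (b c : R) : (p < L)%N -> 0 <= b -> 0 <= c -> bmeas f -> (forall u, `|f u| <= b) ->
  (forall h (x : R), 0 <= x -> bmeas h -> (forall u, `|h u| <= x) ->
     L4bound Ex (fun w => emp N U p h w - eta p h) (c * x)) ->
  L4bound Ex (fun w => upd p f w - eta p.+1 f) (c * (2 * K + 1) * b).
Proof.
move=> pL b0 c0 bf fb He; under eq_fun do rewrite upd_err//.
have bG := Gn_bmeas p; have b1 : bmeas (fun _ : E => 1 : R) by exact: bmeas_cst.
have nG u : `|Gn p u| <= K by rewrite gtr0_norm ?Gn_gt0.
have nfG u : `|f u * Gn p u| <= b * K by rewrite normrM; apply: ler_pM.
have H1 := He (fun u => f u * Gn p u) (b * K) (mulr_ge0 b0 K0) (bmeasM bf bG) nfG.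
have nD u : `|Gn p u - 1| <= K + 1.
  by apply: le_trans (ler_normB _ _) _; rewrite normr1 lerD2r.
have H2 := He (fun u => Gn p u - 1) (K + 1) (addr_ge0 K0 ler01) (bmeasB bG b1) nD.
have bu : bmeas (upd p f) by exact: adapted_bmeas (upd_adapted p.+1 0 p f (ltnSn p) pL bf).
have H3 : L4bound Ex (fun w => -1 * (upd p f w * (emp N U p (fun u => Gn p u - 1) w - eta p (fun u => Gn p u - 1))))
    (`|b| * (c * (K + 1))).
  apply: (L4bound_dom Ex_mean _ _ (L4boundZ Ex_mean b H2)) => [|w].
    by apply: bmeasZ; apply: bmeasM => //; exact: L4bound_bmeas H2.
  rewrite mulN1r normrN normrM [leRHS]normrM; apply: ler_wpM2r => //.
  by rewrite (ger0_norm b0); exact: (upd_norm p f b w pL bf fb).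
have := L4boundD Ex_mean H1 H3.
rewrite (_ : c * (b * K) + _ = c * (2 * K + 1) * b); last by rewrite ger0_norm//; ring.
by under eq_fun do rewrite mulN1r.
Qed.

(** The normalisation needs (A1), so it starts at level 1. For r >= 1 the effect of level 0 is the
    gap between the conditional law of level 1 and eta_1, that is, an update error at level 0
    followed by the kernel. *)
Lemma Tr0_L4 r f (b : R) : (r < L)%N -> bmeas f -> 0 <= b -> (forall u, `|f u| <= b) ->
  L4bound Ex (Tr r f 0) (C1 * b * kp ^+ r / Num.sqrt (N 0)%:R).
Proof.
case: r => [|r] rL bf b0 fb.
  have := sampling_error_L4 0 f b b0 rL bf fb.
  rewrite (_ : Tr 0 f 0 = fun w => emp N U 0 f w - smean 0 f w); last first.
    by apply/funext => w; rewrite /Tr /Wr /= (mean_cst (emp_mean 0 w rL)) divr1.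
  apply: L4bound_le; rewrite expr0 mulr1 ler_wpM2r ?invr_ge0// ler_wpM2r//.
  by apply: le_trans C1_large; have := B2; lra.
have L0 : (0 < L)%N by exact: leq_ltn_trans rL.
have L1 : (1 <= L)%N by [].
have [m [phi [psi [bphi bpsi Hpsi Hphi H]]]] := FK_ratio_normalize r 1 f b isT bf fb.
set dl := 2 * b * kp ^+ r in Hphi.
have dl0 : 0 <= dl by rewrite !mulr_ge0// exprn_ge0// ltW.
have [npsi nphi] := FK_normalized_norm dl0 Hpsi Hphi.
have -> : Tr r.+1 f 0 = fun w => smean 1 phi w / smean 1 psi w - eta 1 phi / eta 1 psi.
  apply/funext => w; rewrite /Tr (Wr_Vr _ _ 0)// /Vr (eta_FK_ratio r.+1 1)// subn1/=.
  have := H _ (smean_mean 1 w L1) => ->.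
  have := H _ (eta_mn 1) => ->.
  by rewrite opprD addrACA subrr add0r.
have Hs w := mean_ratioP _ _ _ _ (smean_mean 1 w L1) bphi bpsi Hpsi Hphi.
have [Hn1 Hn2 Hn3] := mean_ratioP _ _ _ _ (eta_mn 1) bphi bpsi Hpsi Hphi.
have He h (x : R) : 0 <= x -> bmeas h -> (forall u, `|h u| <= x) ->
     L4bound Ex (fun w => emp N U 0 h w - eta 0 h) (3 / Num.sqrt (N 0)%:R * x).
  by move=> x0 bh hx; have := sampling_error_L4 0 h x x0 L0 bh hx; rewrite mulrAC.
have c0 : 0 <= 3 / Num.sqrt (N 0)%:R :> R by rewrite divr_ge0.
have S h (x : R) : 0 <= x -> bmeas h -> (forall u, `|h u| <= x) ->
    L4bound Ex (fun w => smean 1 h w - eta 1 h) (3 / Num.sqrt (N 0)%:R * (2 * K + 1) * x).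
  move=> x0 bh hx; have bk := kapply_bmeas (M := M) 1 bh.
  have := upd_L4 0 (kapply M 1 h) x _ L0 x0 c0 bk
    (fun u => mean_norm (kapply_mean 1 u) bh hx) He.
  under eq_fun do rewrite upd_smean//.
  by rewrite (eta_kapply gam_meas gam_pos Z_fin Z_pos M_inv).
have e1 := S phi (dl * B) (mulr_ge0 dl0 (ltW B0)) bphi nphi.
have e2 := S psi B (ltW B0) bpsi npsi.
have := ratio_diff_L4 _ _ _ _ dl _ _ dl0
  (smean_bmeas _ L1 bphi) (smean_bmeas _ L1 bpsi) (bmeas_cst _) (bmeas_cst _)
  (fun w => let: And3 h _ _ := Hs w in h) (fun w => let: And3 _ h _ := Hs w in h)
  (fun w => let: And3 _ _ h := Hs w in h)
  (fun=> Hn1) (fun=> Hn2) (fun=> Hn3) e1 e2.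
apply: L4bound_le; rewrite exprS /C1 /dl le_eqVlt; apply/orP; left; apply/eqP.
by have [->|s0] := eqVneq (Num.sqrt (N 0)%:R : R) 0; [rewrite invr0; ring | field; rewrite s0 gt_eqF].
Qed.

Lemma Tr_L4 r s f (b : R) : (s <= r < L)%N -> bmeas f -> 0 <= b -> (forall u, `|f u| <= b) ->
  L4bound Ex (Tr r f s) (C1 * b * kp ^+ (r - s) / Num.sqrt (N s)%:R).
Proof.
case: s => [|s]; last exact: Tr_succ_L4.
by move=> /andP[_ rL]; rewrite subn0; exact: Tr0_L4.
Qed.

(** * Sampling bias and covariances of empirical errors *)

Definition C3 := C1 / (1 - kp).
Definition C4 := (C1 + C2) / (1 - kp).
(** 2 C3 is the size of an increment; 2 C4 pays for its covariance with the linear part of the later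
    one, C3^2 (2 K + 1) for the product of two errors. *)
Definition C5 := 2 * C3 * (2 * C4 + C3 ^+ 2 * (2 * K + 1)).

Let kp1' : 0 < 1 - kp. Proof. by rewrite subr_gt0. Qed.
Let C2_ge0 : 0 <= C2. Proof. by rewrite mulr_ge0// exprn_ge0// ltW. Qed.
Let C3_ge0 : 0 <= C3. Proof. exact: (divr_ge0 C1_ge0 (ltW kp1')). Qed.
Let C4_ge0 : 0 <= C4. Proof. exact: (divr_ge0 (addr_ge0 C1_ge0 C2_ge0) (ltW kp1')). Qed.
(** The linearisation at (a', b') and the exact difference of ratios differ only by having 1 / b'
    instead of 1 / b, which yields one more factor b - b'. *)
Lemma ratio_second_order (a b a' b' dl : R) : 0 <= dl ->
  B^-1 <= b -> B^-1 <= b' -> 0 <= a' -> a' <= dl * b' ->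
  `|((a - a') - a' / b' * (b - b')) / b' - (a / b - a' / b')| <=
  B ^+ 2 * ((`|a - a'| + dl * `|b - b'|) * `|b - b'|).
Proof.
have Bi : 0 < B^-1 by rewrite invr_gt0.
move=> dl0 /[dup] Bb /(lt_le_trans Bi) b0 /[dup] Bb' /(lt_le_trans Bi) b'0 a'0 a'b'.
have -> : ((a - a') - a' / b' * (b - b')) / b' - (a / b - a' / b') =
    (b^-1 * b'^-1) * (((a - a') - a' / b' * (b - b')) * (b - b')).
  by field; rewrite !gt_eqF.
have inv x : 0 < x -> B^-1 <= x -> `|x^-1| <= B.
  by move=> x0 Bx; rewrite gtr0_norm ?invr_gt0// -[leRHS]invrK lef_pV2// posrE.
rewrite normrM; apply: ler_pM => //.
  by rewrite normrM expr2; apply: ler_pM => //; exact: inv.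
rewrite normrM ler_wpM2r//; apply: le_trans (ler_normB _ _) _; rewrite lerD2l normrM ler_wpM2r//.
by rewrite ger0_norm ?divr_ge0 ?(ltW b'0)// ler_pdivrMr.
Qed.

(* The first-order part of the sampling error of level s is orthogonal to the past, so only
   the quadratic remainder contributes. *)
Lemma Tr_bias r s f (b : R) X (a : R) : (s < r < L)%N -> bmeas f -> 0 <= b ->
  (forall u, `|f u| <= b) -> adapted s.+1 0 X -> L2bound Ex X a ->
  `|Ex (fun w => X w * Tr r f s.+1 w)| <= a * (C2 * b * kp ^+ (r - s.+1) / (N s.+1)%:R).
Proof.
move=> /[dup] srL /andP[sr rL] bf b0 fb aX hX.
have sL : (s.+1 < L)%N by exact: leq_ltn_trans sr rL.
have bT := L4bound_bmeas (Tr_succ_L4 r s f b srL bf b0 fb).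
have [m [phi [psi [bphi bpsi Hpsi Hphi H]]]] := FK_ratio_normalize (r - s.+1) s.+1 f b isT bf fb.
set dl := 2 * b * kp ^+ (r - s.+1) in Hphi.
have dl0 : 0 <= dl by rewrite !mulr_ge0// exprn_ge0// ltW.
have [npsi nphi] := FK_normalized_norm dl0 Hpsi Hphi.
have TE w : Tr r f s.+1 w = emp N U s.+1 phi w / emp N U s.+1 psi w -
    smean s.+1 phi w / smean s.+1 psi w.
  rewrite Tr_succ// /Wr /Vr.
  have := H _ (emp_mean s.+1 w sL) => ->.
  have := H _ (smean_mean s.+1 w (ltnW sL)) => ->.
  by rewrite opprD addrACA subrr add0r.
have He w := mean_ratioP _ _ _ _ (emp_mean s.+1 w sL) bphi bpsi Hpsi Hphi.
have Hs w := mean_ratioP _ _ _ _ (smean_mean s.+1 w (ltnW sL)) bphi bpsi Hpsi Hphi.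
have e1 := sampling_error_L4 s.+1 phi (dl * B) (mulr_ge0 dl0 (ltW B0)) sL bphi nphi.
have e2 := sampling_error_L4 s.+1 psi B (ltW B0) sL bpsi npsi.
set e1w := (fun w => _) in e1; set e2w := (fun w => _) in e2.
have mu0 w : 0 < smean s.+1 psi w by have [h _ _] := Hs w; apply: lt_le_trans h; rewrite invr_gt0.
(* The coefficients of the linearised error depend only on the past, so they can be absorbed into
   the adapted factor before orthogonality is used. *)
pose Y w := X w / smean s.+1 psi w.
pose c w := smean s.+1 phi w / smean s.+1 psi w.
have apsi := adapted_smean s.+1 0 psi (ltnW sL) bpsi.
have aphi := adapted_smean s.+1 0 phi (ltnW sL) bphi.
have aY : adapted s.+1 0 Y.
  have [_ [x Xx]] := L2bound_bmeas hX.
  apply: (adapted_div (x * B)) => // w; have [h _ _] := Hs w.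
  apply: (le_trans (Xx w)); rewrite -mulrA ler_peMr ?(le_trans (normr_ge0 _) (Xx w))//.
  by rewrite -(mulVf (lt0r_neq0 B0)) mulrC ler_wpM2l// ltW.
have ac : adapted s.+1 0 c.
  apply: (adapted_div dl) => // w; have [_ h1 h2] := Hs w.
  by rewrite ger0_norm.
have aYc := adaptedM aY ac.
have O1 := Ex_emp_orthogonal s.+1 Y phi sL aY bphi.
have O2 := Ex_emp_orthogonal s.+1 _ psi sL aYc bpsi.
pose Lam w := (e1w w - c w * e2w w) / smean s.+1 psi w.
pose rem w := Lam w - Tr r f s.+1 w.
have b1 := bmeasM (adapted_bmeas aY) (L4bound_bmeas e1).
have b2 := bmeasM (adapted_bmeas aYc) (L4bound_bmeas e2).
have ai : adapted s.+1 0 (fun w => 1 / smean s.+1 psi w).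
  apply: (adapted_div B) => // [|w]; first exact: adapted_cst.
  have [h _ _] := Hs w; rewrite normr1 -(mulVf (lt0r_neq0 B0)) mulrC ler_wpM2l// ltW//.
have bLam : bmeas Lam.
  rewrite (_ : Lam = fun w => (e1w w - c w * e2w w) * (1 / smean s.+1 psi w)); last first.
    by apply/funext => w; rewrite /Lam mul1r.
  apply: bmeasM; last exact: adapted_bmeas ai.
  apply: bmeasB; first exact: L4bound_bmeas e1.
  by apply: bmeasM; [exact: adapted_bmeas ac | exact: L4bound_bmeas e2].
have brem : bmeas rem by exact: bmeasB.
have bX := L2bound_bmeas hX.
(* The error is its linearisation [Lam] minus [rem], and X times [Lam] has mean zero. *)
have -> : Ex (fun w => X w * Tr r f s.+1 w) = - Ex (fun w => X w * rem w).
  rewrite (_ : (fun w => X w * Tr r f s.+1 w) =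
    fun w => (Y w * e1w w - Y w * c w * e2w w) - X w * rem w); last first.
    by apply/funext => w; rewrite /rem /Lam /Y; ring.
  rewrite (meanB Ex_mean (bmeasB b1 b2) (bmeasM bX brem)) (meanB Ex_mean b1 b2).
  by rewrite [X in X - _ - _]O1 [X in _ - X - _]O2 subrr sub0r.
rewrite normrN.
have H1 := L4boundD Ex_mean (L4bound_norm e1) (L4boundZ Ex_mean dl (L4bound_norm e2)).
have H2 := L2boundZ Ex_mean (B ^+ 2) (L2boundM Ex_mean H1 (L4bound_norm e2)).
rewrite (ger0_norm dl0) ger0_norm in H2; last by rewrite exprn_ge0// ltW.
have Hrem : L2bound Ex rem (C2 * b * kp ^+ (r - s.+1) / (N s.+1)%:R).
  apply: (L2bound_le _ (L2bound_dom Ex_mean brem _ H2)).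
    have N0 : 0 < (N s.+1)%:R :> R by rewrite ltr0n N_gt0.
    have sq : (N s.+1)%:R = Num.sqrt (N s.+1)%:R ^+ 2 :> R by rewrite sqr_sqrtr// ltW.
    have sq0 : Num.sqrt (N s.+1)%:R != 0 :> R by rewrite gt_eqF// sqrtr_gt0.
    rewrite /C2 sq sqrtr_sqr ger0_norm// /dl le_eqVlt; apply/orP; left; apply/eqP.
    by field.
  move=> w; have [h1 h2 h3] := He w; have [h1' h2' h3'] := Hs w.
  rewrite /rem /Lam TE [leRHS]ger0_norm; first exact: ratio_second_order.
  by rewrite mulr_ge0 ?exprn_ge0 ?(ltW B0)// mulr_ge0// addr_ge0// mulr_ge0.
exact: (mean_cauchy_schwarz Ex_mean hX Hrem).
Qed.

Lemma N_antitone s r : (s <= r < L)%N -> (N r <= N s)%N.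
Proof.
elim: r => [|r IH] /andP[sr rL]; first by move: sr; rewrite leqn0 => /eqP ->.
move: sr; rewrite leq_eqVlt => /orP[/eqP -> //|sr].
apply: (leq_trans (N_mono r rL)); apply: IH.
by rewrite -ltnS sr/= ltnW.
Qed.

Lemma geometric_sum r : \sum_(0 <= s < r.+1) kp ^+ (r - s) <= (1 - kp)^-1.
Proof.
elim: r => [|r IH].
  by rewrite big_nat1 expr0 -[leLHS]invr1 lef_pV2 ?posrE// lerBlDr lerDl ltW.
rewrite big_nat_recr//= subnn expr0.
under eq_big_nat => s /andP[_ sr] do rewrite subSn// exprS.
rewrite -mulr_sumr; have := ler_wpM2l (ltW kp0) IH => h.
apply: (le_trans (lerD h (lexx 1))); rewrite le_eqVlt; apply/orP; left; apply/eqP.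
by field; rewrite gt_eqF.
Qed.

Let iN s r : (s <= r < L)%N -> ((N s)%:R)^-1 <= ((N r)%:R)^-1 :> R.
Proof.
move=> srL; have rL : (r < L)%N by case/andP: srL.
have Nr := N_gt0 r rL; have le := N_antitone s r srL.
by rewrite lef_pV2 ?posrE ?ltr0n ?ler_nat// (leq_trans Nr).
Qed.

Let isN s r : (s <= r < L)%N -> (Num.sqrt (N s)%:R)^-1 <= (Num.sqrt (N r)%:R)^-1 :> R.
Proof.
move=> srL; have rL : (r < L)%N by case/andP: srL.
have Nr := N_gt0 r rL; have le := N_antitone s r srL.
by rewrite lef_pV2 ?posrE ?sqrtr_gt0 ?ltr0n ?ler_wsqrtr ?ler_nat// (leq_trans Nr).
Qed.

Lemma emp_L4 r f (b : R) : (r < L)%N -> bmeas f -> 0 <= b -> (forall u, `|f u| <= b) ->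
  L4bound Ex (fun w => emp N U r f w - eta r f) (C3 / Num.sqrt (N r)%:R * b).
Proof.
move=> rL bf b0 fb.
have := L4bound_sum Ex_mean r.+1 (Tr r f) (fun s => C1 * b * kp ^+ (r - s) / Num.sqrt (N s)%:R).
under eq_fun do rewrite -sum_Tr//.
move=> H; apply: L4bound_le (H _); last first.
  by move=> s sr; apply: Tr_L4 => //; rewrite -ltnS sr.
apply: (@le_trans _ _ (\sum_(0 <= s < r.+1) C1 * b / Num.sqrt (N r)%:R * kp ^+ (r - s))).
  apply: ler_sum_nat => s /andP[_ sr]; rewrite mulrAC; apply: ler_wpM2r.
    by rewrite exprn_ge0// ltW.
  by apply: ler_wpM2l; [exact: mulr_ge0 | apply: isN; rewrite -ltnS sr].
rewrite -mulr_sumr /C3.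
have -> : C1 / (1 - kp) / Num.sqrt (N r)%:R * b = C1 * b / Num.sqrt (N r)%:R * (1 - kp)^-1.
  by ring.
apply: ler_wpM2l (geometric_sum r).
exact: (divr_ge0 (mulr_ge0 C1_ge0 b0) (sN r)).
Qed.

Lemma emp_covariance p r f (b : R) X (a : R) : (p < r < L)%N -> bmeas f -> 0 <= b ->
  (forall u, `|f u| <= b) -> (forall s, (p < s)%N -> adapted s 0 X) -> L2bound Ex X a ->
  `|Ex (fun w => X w * (emp N U r f w - eta r f))| <=
  a * (C4 * b * (kp ^+ (r - p) / Num.sqrt (N p)%:R + ((N r)%:R)^-1)).
Proof.
move=> /andP[pr rL] bf b0 fb aX hX; have a0 := L2bound_ge0 hX; have bX := L2bound_bmeas hX.
pose beta s := a * (if (s <= p)%N then C1 * b * kp ^+ (r - s) / Num.sqrt (N s)%:R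
                    else C2 * b * kp ^+ (r - s) / (N s)%:R).
have H s : (0 <= s < r.+1)%N -> bmeas (fun w => X w * Tr r f s w) /\
    `|Ex (fun w => X w * Tr r f s w)| <= beta s.
  move=> /andP[_ sr]; have hT := Tr_L4 r s f b (introT andP (conj sr rL)) bf b0 fb.
  split; first exact: (bmeasM bX (L4bound_bmeas hT)).
  rewrite /beta; case: ifPn => [_|]; first exact: (mean_cauchy_schwarz Ex_mean hX (L4_L2bound Ex_mean hT)).
  rewrite -ltnNge; case: s sr {hT} => [//|s] sr ps.
  by apply: Tr_bias => //; [rewrite -ltnS sr | exact: aX].
have [_] := mean_norm_sum Ex_mean H.
rewrite (_ : (fun w => _) = (fun w => X w * (emp N U r f w - eta r f))); last first.
  by apply/funext => w; rewrite sum_Tr// mulr_sumr.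
move/le_trans; apply; rewrite /beta -mulr_sumr ler_wpM2l//.
rewrite (@big_cat_nat _ _ _ p.+1)//=; last by rewrite ltnW// ltnS.
have k0 n : 0 <= kp ^+ n by rewrite exprn_ge0// ltW.
have S1 : \sum_(0 <= s < p.+1) (if (s <= p)%N then C1 * b * kp ^+ (r - s) / Num.sqrt (N s)%:R
      else C2 * b * kp ^+ (r - s) / (N s)%:R) <=
    C1 * b * (kp ^+ (r - p) / Num.sqrt (N p)%:R) * (1 - kp)^-1.
  have c0 : 0 <= C1 * b * (kp ^+ (r - p) / Num.sqrt (N p)%:R).
    exact: (mulr_ge0 (mulr_ge0 C1_ge0 b0) (divr_ge0 (k0 _) (sN p))).
  apply: le_trans (ler_wpM2l c0 (geometric_sum p)).
  rewrite mulr_sumr; apply: ler_sum_nat => s /andP[_ sp]; rewrite -ltnS sp.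
  (* Extracting the decay from p to r leaves a geometric sum over s <= p, while monotonicity of N
     allows N_s to be replaced by N_p. *)
  have -> : kp ^+ (r - s) = kp ^+ (r - p) * kp ^+ (p - s).
    by rewrite -exprD addnBA// subnK// ltnW.
  have -> : C1 * b * (kp ^+ (r - p) * kp ^+ (p - s)) / Num.sqrt (N s)%:R =
    C1 * b * (kp ^+ (r - p) / Num.sqrt (N s)%:R) * kp ^+ (p - s) by ring.
  apply: ler_wpM2r => //; apply: ler_wpM2l; first exact: (mulr_ge0 C1_ge0 b0).
  by apply: ler_wpM2l => //; apply: isN; rewrite -ltnS sp (ltn_trans pr rL).
have S2 : \sum_(p.+1 <= s < r.+1) (if (s <= p)%N then C1 * b * kp ^+ (r - s) / Num.sqrt (N s)%:R
      else C2 * b * kp ^+ (r - s) / (N s)%:R) <= C2 * b * ((N r)%:R)^-1 * (1 - kp)^-1.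
  have c0 : 0 <= C2 * b * ((N r)%:R)^-1 by exact: (divr_ge0 (mulr_ge0 C2_ge0 b0) (ler0n _ _)).
  apply: le_trans (ler_wpM2l c0 (geometric_sum r)).
  rewrite mulr_sumr [leRHS](@big_cat_nat _ _ _ p.+1 0%N r.+1)//=; last by rewrite ltnW// ltnS.
  apply: ler_wpDl; first by apply: sumr_ge0 => s _; exact: (mulr_ge0 c0 (k0 _)).
  apply: ler_sum_nat => s /andP[ps sr]; rewrite leqNgt ps /=.
  rewrite mulrAC; apply: ler_wpM2r => //.
  by apply: ler_wpM2l; [exact: mulr_ge0 | apply: iN; rewrite -ltnS sr].
apply: (le_trans (lerD S1 S2)).
have i0 : 0 <= (1 - kp)^-1 by rewrite invr_ge0 ltW.
rewrite /C4; set x := kp ^+ (r - p) / _; set y := ((N r)%:R)^-1.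
have x0 : 0 <= x by rewrite mulr_ge0 ?invr_ge0.
have y0' : 0 <= y by rewrite invr_ge0.
rewrite -subr_ge0.
have -> : (C1 + C2) / (1 - kp) * b * (x + y) - (C1 * b * x / (1 - kp) + C2 * b * y / (1 - kp)) =
  (1 - kp)^-1 * (b * (C2 * x + C1 * y)) by ring.
exact: (mulr_ge0 i0 (mulr_ge0 b0 (addr_ge0 (mulr_ge0 C2_ge0 x0) (mulr_ge0 C1_ge0 y0')))).
Qed.

(** * Increments of the estimator and their covariances *)

Definition Dn p u := Gn p u - 1.

Definition Xp p (g : E -> R) w := (upd p g w - emp N U p g w) - (eta p.+1 g - eta p g).

Lemma Dn_bmeas p : bmeas (Dn p).
Proof. by apply: bmeasB; [exact: Gn_bmeas | exact: bmeas_cst]. Qed.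

(** This form, with a bounded coefficient in front of the second error, suffices for the size of an
    increment. *)
Lemma Xp_sampling p g w : (p < L)%N -> bmeas g -> Xp p g w =
  (emp N U p (fun u => g u * Dn p u) w - eta p (fun u => g u * Dn p u)) -
  upd p g w * (emp N U p (Dn p) w - eta p (Dn p)).
Proof.
move=> pL bg; have em := emp_mean p w pL; have bG := Gn_bmeas p.
have -> : (fun u => g u * Dn p u) = (fun u => g u * Gn p u - g u).
  by apply/funext => u; rewrite /Dn; ring.
rewrite (meanB em)//; last exact: bmeasM.
rewrite (meanB (eta_mn p))//; last exact: bmeasM.
have := upd_err p g w pL bg; rewrite -/(Dn p) /Xp eta_Gn// => H.
transitivity ((upd p g w - eta p.+1 g) - emp N U p g w + eta p g); first by ring.
by rewrite H; ring.
Qed.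

(** Centring g replaces the coefficient of order one by an error, so the nonlinear part is of second
    order; covariances require this gain. *)
Lemma Xp_expansion p g w : (p < L)%N -> bmeas g -> Xp p g w =
  (emp N U p (fun u => (g u - eta p.+1 g) * Dn p u) w -
   eta p (fun u => (g u - eta p.+1 g) * Dn p u)) -
  (upd p g w - eta p.+1 g) * (emp N U p (Dn p) w - eta p (Dn p)).
Proof.
move=> pL bg; have em := emp_mean p w pL; have bD := Dn_bmeas p.
rewrite Xp_sampling//; set a := eta p.+1 g.
have -> : (fun u => (g u - a) * Dn p u) = (fun u => g u * Dn p u - a * Dn p u).
  by apply/funext => u; ring.
have bgD : bmeas (fun u => g u * Dn p u) by exact: bmeasM.
have baD : bmeas (fun u => a * Dn p u) by exact: bmeasZ.
by rewrite (meanB em bgD baD) (meanB (eta_mn p) bgD baD) (meanZ em a bD) (meanZ (eta_mn p) a bD); ring.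
Qed.

Lemma Xp_adapted s n p g : (p < s)%N -> (p < L)%N -> bmeas g -> adapted s n (Xp p g).
Proof.
move=> ps pL bg; apply: adaptedB; last exact: adapted_cst.
by apply: adaptedB; [exact: upd_adapted | exact: adapted_emp].
Qed.

Context {dn : nat -> R} (dn_ge0 : forall p, 0 <= dn p) (Dn_le : forall p u, `|Dn p u| <= dn p).

Lemma emp_Dn_L4 p : (p < L)%N ->
  L4bound Ex (fun w => emp N U p (Dn p) w - eta p (Dn p)) (C3 / Num.sqrt (N p)%:R * dn p).
Proof. by move=> pL; apply: emp_L4 => //; exact: Dn_bmeas. Qed.

Lemma Xp_L4 p g : (p < L)%N -> bmeas g -> (forall u, `|g u| <= 1) ->
  L4bound Ex (Xp p g) (2 * C3 * dn p / Num.sqrt (N p)%:R).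
Proof.
move=> pL bg g1; have bD := Dn_bmeas p.
have gD u : `|g u * Dn p u| <= dn p.
  by rewrite normrM -[leRHS]mul1r; apply: ler_pM.
have H1 := emp_L4 p _ (dn p) pL (bmeasM bg bD) (dn_ge0 p) gD.
have H2 := emp_Dn_L4 p pL.
have bu : bmeas (upd p g) by exact: adapted_bmeas (upd_adapted p.+1 0 p g (ltnSn p) pL bg).
have H3 : L4bound Ex (fun w => -1 * (upd p g w * (emp N U p (Dn p) w - eta p (Dn p))))
    (C3 / Num.sqrt (N p)%:R * dn p).
  apply: (L4bound_dom Ex_mean _ _ H2) => [|w].
    by apply: bmeasZ; apply: bmeasM => //; exact: L4bound_bmeas H2.
  rewrite mulN1r normrN normrM ler_piMl//; exact: upd_norm.
have := L4boundD Ex_mean H1 H3.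
rewrite (_ : C3 / _ * _ + _ = 2 * C3 * dn p / Num.sqrt (N p)%:R); last by ring.
rewrite (_ : (fun w => _) = Xp p g)//.
by apply/funext => w; rewrite Xp_sampling// mulN1r.
Qed.

Lemma Xp_covariance p r g : (p < r < L)%N -> bmeas g -> (forall u, `|g u| <= 1) ->
  `|Ex (fun w => Xp p g w * Xp r g w)| <=
  C5 * (dn p * dn r * (kp ^+ (r - p) / (N p)%:R + (Num.sqrt (N p)%:R * (N r)%:R)^-1)).
Proof.
move=> /[dup] prL /andP[pr rL] bg g1; have pL := ltn_trans pr rL.
have hX := L4_L2bound Ex_mean (Xp_L4 p g pL bg g1).
have bX := L2bound_bmeas hX; have bD := Dn_bmeas r.
set a := eta r.+1 g; pose h u := (g u - a) * Dn r u.
have a1 : `|a| <= 1 by exact: (mean_norm (eta_mn r.+1)).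
have bh : bmeas h by apply: bmeasM => //; apply: bmeasB => //; exact: bmeas_cst.
have nh u : `|h u| <= 2 * dn r.
  rewrite normrM; apply: ler_pM => //; apply: le_trans (ler_normB _ _) _.
  by rewrite -[2]/(1 + 1); exact: lerD.
have dr0 : 0 <= 2 * dn r by rewrite mulr_ge0.
have H1 := emp_covariance p r h (2 * dn r) (Xp p g) _ prL bh dr0 nh
  (fun s ps => Xp_adapted s 0 p g ps pL bg) hX.
have c0 : 0 <= C3 / Num.sqrt (N r)%:R by rewrite divr_ge0.
have HA := upd_L4 r g 1 _ rL ler01 c0 bg g1 (fun f x x0 bf fx => emp_L4 r f x rL bf x0 fx).
(* Two factors of L^4 order N_r^(-1/2) give a product of L^2 order 1 / N_r; paired with X_p this is
   already the second term of the bound. *)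
have HQ := L2boundM Ex_mean HA (emp_Dn_L4 r rL).
have H2 := mean_cauchy_schwarz Ex_mean hX HQ.
have bE := bmeasM bX (bmeasB (emp_bmeas r _ bh) (bmeas_cst (T := Om) (eta r h))).
have bQ := bmeasM bX (L2bound_bmeas HQ).
have -> : Ex (fun w => Xp p g w * Xp r g w) =
    Ex (fun w => Xp p g w * (emp N U r h w - eta r h)) -
    Ex (fun w => Xp p g w * ((upd r g w - a) * (emp N U r (Dn r) w - eta r (Dn r)))).
  rewrite -(meanB Ex_mean)//; congr Ex; apply/funext => w.
  by rewrite (Xp_expansion r)// -/a; ring.
apply: le_trans (ler_normB _ _) _; apply: (le_trans (lerD H1 H2)).
have Np : 0 < (N p)%:R :> R by rewrite ltr0n N_gt0.
have Nr : 0 < (N r)%:R :> R by rewrite ltr0n N_gt0.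
have sqp : (N p)%:R = Num.sqrt (N p)%:R ^+ 2 :> R by rewrite sqr_sqrtr// ltW.
have sqr' : (N r)%:R = Num.sqrt (N r)%:R ^+ 2 :> R by rewrite sqr_sqrtr// ltW.
have sp0 : 0 < Num.sqrt (N p)%:R :> R by rewrite sqrtr_gt0.
have sr0 : 0 < Num.sqrt (N r)%:R :> R by rewrite sqrtr_gt0.
rewrite sqp sqr' !sqrtr_sqr !ger0_norm// /C5.
move: (Num.sqrt _) sp0 (Num.sqrt _) sr0 => x x0 y y0'.
have k0 : 0 <= kp ^+ (r - p) by rewrite exprn_ge0// ltW.
move: (kp ^+ _) k0 => k k0.
rewrite -subr_ge0.
have -> : 2 * C3 * (2 * C4 + C3 ^+ 2 * (2 * K + 1)) * (dn p * dn r * (k / x ^+ 2 + (x * y ^+ 2)^-1)) -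
  (2 * C3 * dn p / x * (C4 * (2 * dn r) * (k / x + (y ^+ 2)^-1)) +
   2 * C3 * dn p / x * (C3 / y * (2 * K + 1) * 1 * (C3 / y * dn r))) =
  2 * C3 * (C3 ^+ 2 * (2 * K + 1)) * (dn p * dn r * (k / x ^+ 2)).
  by field; rewrite !gt_eqF.
have K21_ge0 := le_trans ler01 K21.
apply: mulr_ge0; first exact: (mulr_ge0 (mulr_ge0 (ler0n _ 2) C3_ge0) (mulr_ge0 (exprn_ge0 2 C3_ge0) K21_ge0)).
exact: (mulr_ge0 (mulr_ge0 (dn_ge0 p) (dn_ge0 r)) (divr_ge0 k0 (exprn_ge0 2 (ltW x0)))).
Qed.

Lemma sqr_sum_nat (X : nat -> R) n : (\sum_(0 <= p < n) X p) ^+ 2 =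
  \sum_(0 <= p < n) X p ^+ 2 + 2 * \sum_(0 <= p < n) \sum_(p.+1 <= r < n) X p * X r.
Proof.
elim: n => [|n IH]; first by rewrite !big_geq// expr0n mulr0 addr0.
have last0 : \sum_(0 <= p < n.+1) \sum_(p.+1 <= r < n.+1) X p * X r =
    \sum_(0 <= p < n) \sum_(p.+1 <= r < n.+1) X p * X r.
  by rewrite big_nat_recr//= [X in _ + X]big_geq// addr0.
rewrite {}last0 !(big_nat_recr n 0)//=.
have -> : \sum_(0 <= p < n) \sum_(p.+1 <= r < n.+1) X p * X r =
    \sum_(0 <= p < n) (\sum_(p.+1 <= r < n) X p * X r + X p * X n).
  by apply: eq_big_nat => p /andP[_ pn]; rewrite big_nat_recr.
by rewrite big_split/= -mulr_suml sqrrD IH; ring.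
Qed.

(** The squared error is at most twice the square of the level-0 error plus twice that of the sum of
    increments: 18 = 2 * 3^2, 8 C3^2 = 2 (2 C3)^2, and 4 C5 counts each ordered pair twice, doubled
    again. *)
Definition C6 := 18 + 8 * C3 ^+ 2 + 4 * C5.

Let C5_ge0 : 0 <= C5.
Proof.
have K21_ge0 := le_trans ler01 K21.
apply: mulr_ge0; first exact: mulr_ge0.
apply: addr_ge0; first exact: mulr_ge0.
by apply: mulr_ge0 => //; exact: exprn_ge0.
Qed.

Lemma Yhat_decomposition g w : (0 < L)%N -> Yhat gam N U L g w - eta L g =
  (emp N U 0 g w - eta 0 g) + \sum_(0 <= p < L) Xp p g w.
Proof.
move=> L0; rewrite /Yhat big_add1/=.
have -> : \sum_(0 <= p < L) Xp p g w = \sum_(0 <= p < L) (upd p g w - emp N U p g w) - (eta L g - eta 0 g).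
  by rewrite -(telescope_sumr (eta^~ g)) // -sumrB.
by rewrite /upd; ring.
Qed.

Lemma Yhat_mse g : (0 < L)%N -> bmeas g -> (forall u, `|g u| <= 1) ->
  bmeas (fun w => Yhat gam N U L g w - eta L g) /\
  Ex (fun w => (Yhat gam N U L g w - eta L g) ^+ 2) <=
  C6 * (((N 0)%:R)^-1 + \sum_(0 <= p < L) dn p * dn p * ((N p)%:R)^-1 +
    \sum_(0 <= p < L) \sum_(p.+1 <= r < L)
      dn p * dn r * (kp ^+ (r - p) / (N p)%:R + (Num.sqrt (N p)%:R * (N r)%:R)^-1)).
Proof.
move=> L0 bg g1.
have H0 := L4_L2bound Ex_mean (sampling_error_L4 0 g 1 ler01 L0 bg g1).
rewrite /smean in H0; have bE := L2bound_bmeas H0.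
have bX p : (p < L)%N -> bmeas (Xp p g) by move=> pL; exact: L4bound_bmeas (Xp_L4 p g pL bg g1).
have [bS1 HS1] : bmeas (fun w => \sum_(0 <= p < L) Xp p g w ^+ 2) /\
    `|Ex (fun w => \sum_(0 <= p < L) Xp p g w ^+ 2)| <=
    \sum_(0 <= p < L) 4 * C3 ^+ 2 * (dn p * dn p * ((N p)%:R)^-1).
  apply: (mean_norm_sum Ex_mean) => p /andP[_ pL]; split; first exact: (bmeasX 2 (bX p pL)).
  have [_ _] := L4_L2bound Ex_mean (Xp_L4 p g pL bg g1).
  rewrite ger0_norm; last by apply: (mean_ge0 Ex_mean) => [|w]; [exact: (bmeasX 2 (bX p pL)) | exact: sqr_ge0].
  move/le_trans; apply; rewrite expr_div_n sqr_sqrtr// le_eqVlt; apply/orP; left; apply/eqP.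
  by ring.
have [bS2 HS2] : bmeas (fun w => \sum_(0 <= p < L) \sum_(p.+1 <= r < L) Xp p g w * Xp r g w) /\
    `|Ex (fun w => \sum_(0 <= p < L) \sum_(p.+1 <= r < L) Xp p g w * Xp r g w)| <=
    \sum_(0 <= p < L) \sum_(p.+1 <= r < L)
      C5 * (dn p * dn r * (kp ^+ (r - p) / (N p)%:R + (Num.sqrt (N p)%:R * (N r)%:R)^-1)).
  apply: (mean_norm_sum Ex_mean) => p /andP[_ pL].
  apply: (mean_norm_sum Ex_mean) => r /andP[pr rL].
  split; first by apply: bmeasM; exact: bX.
  by apply: Xp_covariance => //; rewrite pr rL.
have bS : bmeas (fun w => \sum_(0 <= p < L) Xp p g w).
  by apply: (proj1 (mean_norm_sum Ex_mean (b := fun p => `|Ex (Xp p g)|) _)) => p /andP[_ pL]; split => //; exact: bX.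
have YE w : Yhat gam N U L g w - eta L g = (emp N U 0 g w - eta 0 g) + \sum_(0 <= p < L) Xp p g w.
  exact: Yhat_decomposition.
have -> : (fun w => Yhat gam N U L g w - eta L g) =
    (fun w => (emp N U 0 g w - eta 0 g) + \sum_(0 <= p < L) Xp p g w).
  by apply/funext => w; exact: YE.
split; first exact: bmeasD.
under eq_fun do rewrite YE.
have [_ _ HE0] := H0.
apply: (@le_trans _ _ (Ex (fun w => 2 * (emp N U 0 g w - eta 0 g) ^+ 2 +
   (2 * (\sum_(0 <= p < L) Xp p g w ^+ 2) +
    4 * (\sum_(0 <= p < L) \sum_(p.+1 <= r < L) Xp p g w * Xp r g w))))).
  apply: (mean_le Ex_mean); first by apply: bmeasX; exact: bmeasD.
    by apply: bmeasD; [|apply: bmeasD]; apply: bmeasZ => //; exact: bmeasX.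
  move=> w; have S2 := sqr_sum_nat (fun p => Xp p g w) L.
  move: (emp N U 0 g w - eta 0 g) (\sum_(0 <= p < L) Xp p g w) S2 => x S.
  move: (\sum_(0 <= p < L) _) (\sum_(0 <= p < L) _) => y z S2.
  have -> : 2 * x ^+ 2 + (2 * y + 4 * z) = 2 * x ^+ 2 + 2 * S ^+ 2 by rewrite S2; ring.
  by have := sqr_ge0 (x - S); nra.
have b0 := bmeasZ 2 (bmeasX 2 bE); have b1 := bmeasZ 2 bS1; have b2 := bmeasZ 4 bS2.
rewrite (meanD Ex_mean b0 (bmeasD b1 b2)) (meanD Ex_mean b1 b2).
rewrite (meanZ Ex_mean _ (bmeasX 2 bE)) (meanZ Ex_mean _ bS1) (meanZ Ex_mean _ bS2).
have {}HS1 := le_trans (ler_norm _) HS1; have {}HS2 := le_trans (ler_norm _) HS2.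
rewrite -mulr_sumr in HS1.
have HS2' : Ex (fun w => \sum_(0 <= p < L) \sum_(p.+1 <= r < L) Xp p g w * Xp r g w) <=
  C5 * \sum_(0 <= p < L) \sum_(p.+1 <= r < L)
      (dn p * dn r * (kp ^+ (r - p) / (N p)%:R + (Num.sqrt (N p)%:R * (N r)%:R)^-1)).
  by rewrite mulr_sumr; under eq_bigr do rewrite mulr_sumr.
rewrite expr_div_n sqr_sqrtr// in HE0.
have i0 : 0 <= ((N 0)%:R)^-1 :> R by rewrite invr_ge0.
have D1 : 0 <= \sum_(0 <= p < L) dn p * dn p * ((N p)%:R)^-1.
  by apply: sumr_ge0 => p _; rewrite !mulr_ge0 ?invr_ge0.
have D2 : 0 <= \sum_(0 <= p < L) \sum_(p.+1 <= r < L)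
      (dn p * dn r * (kp ^+ (r - p) / (N p)%:R + (Num.sqrt (N p)%:R * (N r)%:R)^-1)).
  apply: sumr_ge0 => p _; apply: sumr_ge0 => r _.
  have k0 : 0 <= kp ^+ (r - p) by rewrite exprn_ge0// ltW.
  apply: mulr_ge0; first exact: mulr_ge0.
  by apply: addr_ge0; [rewrite divr_ge0 | rewrite invr_ge0 mulr_ge0].
have c3 : 0 <= C3 ^+ 2 by exact: exprn_ge0.
apply: (le_trans (lerD (ler_wpM2l (ler0n _ 2) HE0) (lerD (ler_wpM2l (ler0n _ 2) HS1) (ler_wpM2l (ler0n _ 4) HS2')))).
rewrite /C6; move: (\sum_(0 <= p < L) _) (\sum_(0 <= p < L) _) D1 D2 => y z y0' z0.
move: (_^-1) i0 (C3 ^+ 2) c3 C5 C5_ge0 => i i0 c c0 c5 c50.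
have -> : 2 * ((3 * 1) ^+ 2 * i) + (2 * (4 * c * y) + 4 * (c5 * z)) = 18 * i + 8 * c * y + 4 * c5 * z by ring.
have -> : (18 + 8 * c + 4 * c5) * (i + y + z) = 18 * i + 8 * c * y + 4 * c5 * z +
  (18 * (y + z) + 8 * (c * (i + z)) + 4 * (c5 * (i + y))) by ring.
by rewrite lerDl !addr_ge0// ?mulr_ge0// ?mulr_ge0// addr_ge0.
Qed.

End ParticleSystem.

(** * Extended-valued norms and the final bound *)

Lemma supnorm_ge {R : realType} {d : measure_display} {E : measurableType d} (f : E -> R) u :
  (`|f u|%:E <= supnorm f)%E.
Proof. by apply: ereal_sup_ubound; exists u. Qed.

Lemma rhs_bound_infinite {R : realType} {d : measure_display} {E : measurableType d}
    (mu : {measure set E -> \bar R}) (gam : nat -> E -> R) (N : nat -> nat) L (kappa : R) :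
  (0 < L)%N -> (0 < N 0)%N -> 0 <= kappa -> (forall l, 0 <= dnorm mu gam l)%E ->
  dnorm mu gam 1 = +oo%E -> rhs_bound mu gam N L kappa = +oo%E.
Proof.
move=> L0 N0 k0 dn0 dn1; rewrite /rhs_bound.
have i0 n : (0 <= (n%:R^-1 : R)%:E)%E by rewrite lee_fin invr_ge0.
have S2 : (0 <= \sum_(1 <= l < L.+1) \sum_(l.+1 <= q < L.+1) dnorm mu gam l * dnorm mu gam q *
     (kappa ^+ (q - l) / (N l.-1)%:R + (Num.sqrt ((N l.-1)%:R) * (N q.-1)%:R)^-1)%:E)%E.
  apply: sume_ge0 => l _; apply: sume_ge0 => q _; apply: mule_ge0; first exact: mule_ge0.
  rewrite lee_fin; apply: addr_ge0; first by rewrite divr_ge0// exprn_ge0.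
  by rewrite invr_ge0 mulr_ge0// sqrtr_ge0.
have -> : (\sum_(1 <= l < L.+1) dnorm mu gam l * dnorm mu gam l * ((N l.-1)%:R^-1)%:E = +oo)%E.
  (* Positivity of N_0 matters: its inverse would otherwise be 0, and 0 times +oo is 0. *)
  rewrite big_ltn// dn1 mulyy gt0_mulye; last by rewrite lte_fin invr_gt0 ltr0n.
  rewrite addye// gt_eqF//; apply: (@lt_le_trans _ _ 0%E); first exact: ltNy0.
  by apply: sume_ge0 => l _; apply: mule_ge0 => //; exact: mule_ge0.
by rewrite addey// addye// gt_eqF// (lt_le_trans _ S2)// ltNy0.
Qed.

Theorem theorem3p1 (R : realType) (d : measure_display) (E : measurableType d)
  (mu : {finite_measure set E -> \bar R})
  (gam : nat -> E -> R)
  (M : nat -> R.-pker E ~> E)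
  (gam_meas : forall l, measurable_fun [set: E] (gam l))
  (gam_pos : forall l u, 0 < gam l u)
  (Z_fin : forall l, (\int[mu]_u (gam l u)%:E < +oo)%E)
  (Z_pos : forall l, (0 < \int[mu]_u (gam l u)%:E)%E)
  (M_inv : forall l, (1 <= l)%N -> forall A, measurable A ->
     (\int[mu]_u (M l u A * (gam l u / Zc mu gam l)%:E) =
      \int[mu]_(u in A) (gam l u / Zc mu gam l)%:E)%E)
  (Cl Cu : R) (HC0 : 0 < Cl) (HC1 : Cl < Cu)
  (A1 : forall l u, (1 <= l)%N -> Cl <= Gp gam l u <= Cu)
  (rho : R) (Hrho : 0 < rho < 1)
  (A2 : forall l, (1 <= l)%N -> forall u v A, measurable A ->
     (rho%:E * M l v A <= M l u A)%E) :
  exists (C kappa : R), 0 < kappa < 1 /\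
  forall (L : nat) (N : nat -> nat), (1 <= L)%N ->
    (forall l, (l < L)%N -> (1 <= N l)%N) ->
    (forall l, (l.+1 < L)%N -> (N l.+1 <= N l)%N) ->
  forall g : E -> R, measurable_fun [set: E] g -> supnorm g = 1%E ->
  forall (d' : measure_display) (Om : measurableType d') (P : probability Om R)
         (U : nat -> nat -> Om -> E),
    particle_system P mu gam M N L U ->
    (\int[P]_w ((Yhat gam N U L g w - eta_ mu gam L g) ^+ 2)%:E
       <= C%:E * rhs_bound mu gam N L kappa)%E.
Proof.
(* Z_0 > 0 forces E to be nonempty; a base point is needed for the normalisation of the
   semigroup. *)
have [y0 _] : exists u : E, True.
  apply: contrapT => nE; have := Z_pos 0; rewrite integral0_eq ?ltxx// => u _.
  by exfalso; apply: nE; exists u.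
have dn0 l : (0 <= dnorm mu gam l)%E by apply: le_trans (supnorm_ge _ y0); rewrite lee_fin.
have [r0 r1] := andP Hrho.
(* The case split depends on the model alone, so the constants may be chosen after it; in the
   infinite case any admissible pair works. *)
have [dn1|dn1] := eqVneq (dnorm mu gam 1) +oo%E.
  exists 1, (1 / 2); split; first by apply/andP; split; lra.
  move=> L N L0 N0 _ g _ _ d' Om P U _.
  by rewrite rhs_bound_infinite// ?N0// ?mul1e ?leey//; lra.
have dn1E : (fine (dnorm mu gam 1))%:E = dnorm mu gam 1.
  by rewrite fineK// ge0_fin_numE// ltey.
(* At level 0 the normalised weight is 1 + D_0. At later levels Z_(l+1) / Z_l = eta_l(G_l) >= Cl, so
   it is at most Cu / Cl. The sum covers both cases and does not involve L or N. *)
pose K := (1 + fine (dnorm mu gam 1)) + Cu / Cl.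
have Z0 l : 0 < Zc mu gam l by exact: Zc_gt0.
have Gn_ge0 l u : 0 < @Gn _ _ _ mu gam l u by exact: Gn_gt0.
have Gn_le l u : @Gn _ _ _ mu gam l u <= K.
  have CuCl : 0 <= Cu / Cl by rewrite divr_ge0 ?ltW// (lt_trans HC0).
  case: l => [|l].
    rewrite ler_wpDr// -lerBlDl -lee_fin dn1E.
    apply: le_trans (supnorm_ge _ u); rewrite lee_fin; exact: ler_norm.
  rewrite ler_wpDl//.
    by rewrite addr_ge0// -lee_fin dn1E.
  have bG := Gp_bmeas gam_meas gam_pos A1 l.+1 isT.
  have em := eta_mean gam_meas gam_pos Z_fin Z_pos l.+1.
  have := eta_Gp gam_pos Z_fin Z_pos l.+1 (fun=> 1).
  under eq_fun do rewrite mul1r; rewrite (mean_cst (eta_mean gam_meas gam_pos Z_fin Z_pos l.+2)) mulr1 => ZE.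
  have : Cl <= eta_ mu gam l.+1 (Gp gam l.+1).
    rewrite -(mean_cst em Cl); apply: (mean_le em) => // [|x]; first exact: bmeas_cst.
    by case/andP: (A1 l.+1 x isT).
  rewrite ZE => h; have /andP[_ Gu] := A1 l.+1 u isT.
  rewrite /Gn mulrC; apply: ler_pM => //; first exact/ltW/Gp_gt0.
    by rewrite divr_ge0// ltW.
  by rewrite -invf_div lef_pV2// posrE// divr_gt0.
(* Shifted by one: [dnorm] is indexed by the level l = p + 1 of the statement. It is finite because
   D_p is bounded by K + 1. *)
pose dn p := fine (dnorm mu gam p.+1).
have dnE p : (dn p)%:E = dnorm mu gam p.+1.
  rewrite /dn fineK// ge0_fin_numE//.
  apply: (@le_lt_trans _ _ (K + 1)%:E); last exact: ltry.
  apply: ge_ereal_sup => _ [u _ <-]; rewrite lee_fin.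
  apply: le_trans (ler_normB _ _) _; rewrite normr1 lerD2r.
  by have := Gn_le p u; rewrite -{1}(gtr0_norm (Gn_ge0 p u)).
have dn_ge0 p : 0 <= dn p by rewrite -lee_fin dnE.
have Dn_le p u : `|@Dn _ _ _ mu gam p u| <= dn p.
  by rewrite -lee_fin dnE; exact: (supnorm_ge (fun u => Zc mu gam p / Zc mu gam p.+1 * Gp gam p u - 1) u).
exists (@C6 R K Cl Cu rho), (kappa rho); split.
  by apply/andP; split; [exact: kappa_gt0 | exact: kappa_lt1].
move=> L N L0 N0 Nmono g mg g1 d' Om P U PS.
have ng u : `|g u| <= 1 by rewrite -lee_fin -g1; exact: supnorm_ge.
have bg : bmeas g by split => //; exists 1.
have [bY HY] := Yhat_mse gam_meas gam_pos Z_fin Z_pos Gn_le N0 PS HC0 HC1 A1 Hrho A2 M_inv Nmono y0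
  dn_ge0 Dn_le g L0 bg ng.
rewrite -(Ex_EFin (bmeasX 2 bY)).
have -> : rhs_bound mu gam N L (kappa rho) =
  (((N 0%N)%:R)^-1 + \sum_(0 <= p < L) dn p * dn p * ((N p)%:R)^-1 +
    \sum_(0 <= p < L) \sum_(p.+1 <= r < L)
      dn p * dn r * (kappa rho ^+ (r - p) / (N p)%:R + (Num.sqrt (N p)%:R * (N r)%:R)^-1))%:E.
  rewrite /rhs_bound !EFinD !big_add1/= -!sumEFin; congr (_ + _ + _)%E.
    by apply: eq_bigr => p _; rewrite !EFinM dnE.
  apply: eq_bigr => p _; rewrite big_add1/= -sumEFin; apply: eq_bigr => r _.
  by rewrite !EFinM !dnE subSS.
by rewrite -EFinM lee_fin.
Qed.
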